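(* Let $k$ be an algebraically closed field of characteristic $2$ and let $F=k(x,y)$ be the field of rational functions in the variables $x,y$ over $k$. Let $a=x$ and $b=x^{-2}y^{-1}+1$. Then the biquadratic extension $F(\wp^{-1}(a),\wp^{-1}(b))/F$ is not excellent.
   Context: For $e\in F$, $\wp^{-1}(e)$ denotes a root of $Y^2+Y+e$ in an algebraic closure of $F$. Over a field of characteristic $2$, quadratic forms are considered possibly singular: up to isometry $\varphi\cong[a_1,b_1]\perp\cdots\perp[a_r,b_r]\perp\langle c_1\rangle\perp\cdots\perp\langle c_s\rangle$, where $[a,b]$ is the form $ax^2+xy+by^2$ and $\langle c\rangle$ is the form $cx^2$. A form is isotropic if it vanishes on some nonzero vector and anisotropic otherwise. Every form decomposes as $\varphi\cong i\times[0,0]\perp j\times\langle 0\rangle\perp\varphi_{an}$ with $\varphi_{an}$ anisotropic and unique up to isometry (the anisotropic part). For an extension $K/F$, $\varphi_K$ denotes the scalar extension. An extension $K/F$ is excellent if for every anisotropic quadratic form $\varphi$ over $F$ there is a quadratic form $\psi$ over $F$ with $(\varphi_K)_{an}\cong\psi_K$. *)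

(* Defs.v *)
From HB Require Import structures.
From mathcomp Require Import all_boot all_order all_algebra all_field.

Set Implicit Arguments.
Unset Strict Implicit.
Unset Printing Implicit Defensive.

Import GRing.Theory.
Local Open Scope ring_scope.

(* A quadratic form of dimension n over F, in any characteristic, is encoded  *)
(* by a coefficient matrix A : 'M[F]_n, not assumed symmetric, standing for   *)
(* the polynomial sum_(i, j) A i j X_i X_j. Every form arises (take A upper   *)
(* triangular). Two matrices give the same form iff they have the same        *)
(* diagonal and the same sums A i j + A j i (i != j); all notions below       *)
(* depend only on the form. Dimension 0 is allowed.                           *)
Definition qform (F : fieldType) (n : nat) (A : 'M[F]_n) (v : 'rV[F]_n) : F :=
  (v *m A *m v^T) 0 0.

Definition isotropic (F : fieldType) (n : nat) (A : 'M[F]_n) : Prop :=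
  exists2 v : 'rV[F]_n, v != 0 & qform A v = 0.

Definition anisotropic (F : fieldType) (n : nat) (A : 'M[F]_n) : Prop :=
  ~ isotropic A.

(* The two dimensions are not assumed convertible: orthogonal sums live in    *)
(* types such as 'M_(m + n). The equations on P and Q force m = n.            *)
Definition isometric (F : fieldType) (m n : nat) (A : 'M[F]_m) (B : 'M[F]_n) :
    Prop :=
  exists (P : 'M[F]_(m, n)) (Q : 'M[F]_(n, m)),
    [/\ P *m Q = 1%:M, Q *m P = 1%:M
      & forall v : 'rV[F]_m, qform B (v *m P) = qform A v].

Definition qsum (F : fieldType) (m n : nat) (A : 'M[F]_m) (B : 'M[F]_n) :
    'M[F]_(m + n) :=
  block_mx A 0 0 B.

Definition qmult (F : fieldType) (i n : nat) (A : 'M[F]_n) :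
    'M[F]_(\sum_(_ < i) n) :=
  \mxdiag_(_ < i) A.

(* [a, b] = a x^2 + x y + b y^2 *)
Definition qbin (F : fieldType) (a b : F) : 'M[F]_(1 + 1) :=
  block_mx a%:M 1%:M 0 b%:M.

(* <c> = c x^2 *)
Definition qdiag1 (F : fieldType) (c : F) : 'M[F]_1 := c%:M.

(* B is an anisotropic part of A; it is unique up to isometry. *)
Definition anisotropic_part (F : fieldType) (n m : nat)
    (A : 'M[F]_n) (B : 'M[F]_m) : Prop :=
  anisotropic B /\
  exists i j : nat,
    isometric A (qsum (qsum (qmult i (qbin 0 0)) (qmult j (qdiag1 0))) B).

Definition qext (F K : fieldType) (f : {rmorphism F -> K}) (n : nat)
    (A : 'M[F]_n) : 'M[K]_n :=
  map_mx f A.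

(* Anisotropic parts exist and are unique up to isometry, so quantifying      *)
(* existentially over the anisotropic part C is harmless.                     *)
Definition excellent (F K : fieldType) (f : {rmorphism F -> K}) : Prop :=
  forall (n : nat) (A : 'M[F]_n), anisotropic A ->
  exists (m : nat) (B : 'M[F]_m) (p : nat) (C : 'M[K]_p),
    anisotropic_part (qext f A) C /\ isometric C (qext f B).

(* k(x, y), as the fraction field of k[x][y]. *)
Definition ratfun2 (k : fieldType) : fieldType := {fraction {poly {poly k}}}.
Definition ratx (k : fieldType) : ratfun2 k := tofrac ('X%:P : {poly {poly k}}).
Definition raty (k : fieldType) : ratfun2 k := tofrac ('X : {poly {poly k}}).

(* z is a value of wp^-1(e) in K: a root of Y^2 + Y + e. *)
Definition wp_inv (F : fieldType) (K : fieldExtType F) (e : F) (z : K) : Prop :=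
  root ('X^2 + 'X + (e%:A)%:P) z.

(* Main.v *)
Require Import Defs.
From HB Require Import structures.
From mathcomp Require Import all_boot all_order all_algebra all_field.
From mathcomp Require Import ring.

Import GRing.Theory.
Local Open Scope ring_scope.

(** Put z = 1 / (x^2 y). Since k contains a primitive cube root of unity w, and
    w^2 + w = 1, the element be = wp^-1(z + 1) + w satisfies be^2 + be = z; put
    also al = wp^-1(x). Thus F = k(x, z) and K = k(al, be) are both rational
    function fields, and F sits in K through x = al^2 + al, z = be^2 + be. A
    degree count in z shows that none of x, z and z + x is of the form u^2 + u
    in F, whence [K : F] = 4 ([dim_K]).

    The form that breaks excellence is the orthogonal sum
      phi = [1, z (w + 1/x)] + x [1, w z].
    It is anisotropic over F ([phi_rat_anisotropic]). Over K it has explicit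
    zeros h0 and h1, attached to the two roots be and be + 1 of Y^2 + Y + z
    ([iso_vec]), and the complement of this hyperbolic pair is
    (al + w) [1, z/x] ([iso_vec_perp]). If the anisotropic part of phi over K came
    from a binary form over F, then (al + w) [1, z/x] would represent an element
    of F over K. The heart of the proof is that it never does, except trivially
    ([twisted_norm]).

    To see this, clear denominators and compare the two leading coefficients in
    be of
      x A = (al + w) (x S^2 + x S T + z T^2),  A in k[x, z], S, T in k[al, be].
    As z = be^2 + be, these coefficients of A are h and n h, with h in k[x] and
    n the degree of A in z. Whatever the parity of n, an element of k[x] times
    al + w or al + w + 1 becomes a square in k[al]; here one uses that
    x + 1 = (al + w) (al + w + 1). Applying the automorphism al |-> al + 1 and
    adding, that element of k[x] is itself a square, so al + w or al + w + 1 would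
    be a square, which is absurd ([descent_nonsquare], [leading_terms],
    [twisted_norm_poly]).

    The link with the definition of excellence is made with planes rather than
    with cancellation: if the anisotropic part of phi over K is defined over F,
    then some plane of phi over K carries the form e b^2 with e in F
    ([defined_anisotropic_part_plane]). Such a plane meets the orthogonal
    complement of h0, where e b^2 is only attained on the line of h0; hence it
    contains h0, and likewise h1. But the polar form vanishes on the plane,
    whereas h0 and h1 are not orthogonal ([no_plane_of_value]). *)

Set Implicit Arguments.
Unset Strict Implicit.
Unset Printing Implicit Defensive.

(** * Characteristic two *)

Lemma eq_of_add0 (R : comNzRingType) (two0 : 2%:R = 0 :> R) (a b : R) :
  a + b = 0 -> a = b.
Proof. by move=> ab; rewrite -[a]addr0 -ab; ring: two0. Qed.

Lemma wpD (R : comNzRingType) (two0 : 2%:R = 0 :> R) (u v : R) :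
  (u + v) ^+ 2 + (u + v) = (u ^+ 2 + u) + (v ^+ 2 + v).
Proof. by ring: two0. Qed.

(** * Polynomials in characteristic two *)

Lemma coefM_top (R : nzRingType) (p q : {poly R}) (m n : nat) :
  (size p <= m.+1)%N -> (size q <= n.+1)%N -> (p * q)`_(m + n) = p`_m * q`_n.
Proof.
move=> sp sq; rewrite coefM.
have lt_m : (m < (m + n).+1)%N by rewrite ltnS leq_addr.
rewrite (bigD1 (Ordinal lt_m)) //= addKn big1 ?addr0 // => i ne_im.
have [lt_im|] := ltnP i m.
  rewrite [q`__]nth_default ?mulr0 //; apply: leq_trans sq _.
  by rewrite ltn_subRL ltn_add2r.
rewrite leq_eqVlt eq_sym => /orP[/eqP im|lt_mi].
  by case/negP: ne_im; apply/eqP/val_inj.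
by rewrite nth_default ?mul0r //; apply: leq_trans sp _.
Qed.

Lemma size_leq_pred (R : nzRingType) (p : {poly R}) (n : nat) :
  (size p <= n.+1)%N -> p`_n = 0 -> (size p <= n)%N.
Proof.
move=> sp pn; apply/leq_sizeP => j; rewrite leq_eqVlt => /orP[/eqP <- //|lt_nj].
by rewrite nth_default //; apply: leq_trans sp _.
Qed.

(** The quadratic form s^2 + s t + ('X + c) t^2 has no zero: the degrees of
    its two square terms have different parities, so they cannot cancel, and
    the mixed term never reaches the larger of them. *)
Lemma wp_form_anisotropic (R : idomainType) (c : R) (s t : {poly R}) :
  s ^+ 2 + s * t + ('X + c%:P) * t ^+ 2 = 0 -> s = 0 /\ t = 0.
Proof.
move=> st0; have: (size t <= maxn (size s) (size t))%N by rewrite leq_maxr.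
have: (size s <= (maxn (size s) (size t)).+1)%N by rewrite leqW ?leq_maxl.
move: (maxn _ _) => n; elim: n => [|n IHn] ss stn.
  have t0 : t = 0 by apply/eqP; rewrite -size_poly_leq0.
  by move: st0; rewrite t0 mulr0 expr0n mulr0 !addr0 => /eqP; rewrite sqrf_eq0 => /eqP.
have sX : (size ('X * t)%R <= n.+2)%N.
  by rewrite (leq_trans (size_polyMleq _ _)) // size_polyX.
have stW := leqW stn.
have E : s * s + s * t + ('X * t * t + c *: (t * t)) = 0.
  by rewrite -[RHS]st0 -mul_polyC; ring.
have ss' : (size s <= n.+1)%N.
  apply: size_leq_pred => //.
  move/(congr1 (fun p : {poly R} => p`_(n.+1 + n.+1))): E.
  rewrite !coefD coefZ !coefM_top // (nth_default _ stn) !mulr0 !addr0 coef0.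
  by move/eqP; rewrite mulf_eq0 orbb => /eqP.
apply: IHn => //; apply: size_leq_pred => //.
move/(congr1 (fun p : {poly R} => p`_(n.+1 + n))): E.
rewrite !coefD coefZ !coefM_top // (nth_default _ ss') (nth_default _ stn).
rewrite coefXM !mul0r mulr0 !add0r addr0 coef0.
by move/eqP; rewrite mulf_eq0 orbb => /eqP.
Qed.

Section Char2.

Variables (R : idomainType) (two0 : 2%:R = 0 :> R).
Implicit Types p q s t : {poly R}.

Let two0P : 2%:R = 0 :> {poly R}.
Proof. by rewrite -polyC_natr two0. Qed.

(** Squaring is additive, so p ^+ 2 only has monomials of even degree. *)
Lemma coef_sqr p i : (p ^+ 2)`_(i.*2) = p`_i ^+ 2 /\ (p ^+ 2)`_(i.*2.+1) = 0.
Proof.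
elim/poly_ind: p i => [|p c IHp] i; first by rewrite expr0n !coef0 expr0n.
have ->: (p * 'X + c%:P) ^+ 2 = p ^+ 2 * 'X^2 + (c ^+ 2)%:P.
  by rewrite rmorphXn /=; ring: two0P.
rewrite !coefD !coefMXn !coefMX !coefC.
case: i => [|i] /=; first by rewrite !add0r.
rewrite subn2 /= !addr0; have [-> ->] := IHp i; split=> //.
Qed.

Lemma deriv_sqr p : (p ^+ 2)^`() = 0.
Proof. by rewrite expr2 derivM; ring: two0P. Qed.

(** 1 and 'X are linearly independent over the subring of squares, because
    squares have zero derivative. *)
Lemma sqr_indep p q : p ^+ 2 + 'X * q ^+ 2 = 0 -> p = 0 /\ q = 0.
Proof.
move=> pq; have q0 : q = 0.
  move/(congr1 (@deriv R)): (pq); rewrite derivD derivM !deriv_sqr derivX deriv0.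
  by rewrite mulr0 mul1r addr0 add0r => /eqP; rewrite sqrf_eq0 => /eqP.
by move: pq; rewrite q0 expr0n mulr0 addr0 => /eqP; rewrite sqrf_eq0 => /eqP.
Qed.

(** Adding the equation to its image under 'X |-> 'X + 1 exhibits h as the
    square r ^+ 2. If q did not vanish, 'X + mu would then be a quotient of
    squares, against its nonzero derivative. *)
Lemma shift_invariant_nonsquare (h q : {poly R}) (mu : R) :
  h \Po ('X + 1) = h -> h * ('X + mu%:P) = q ^+ 2 -> q = 0.
Proof.
move=> hh hq; pose r := q + (q \Po ('X + 1)).
have hr : h = r ^+ 2.
  have -> : r ^+ 2 = q ^+ 2 + (q \Po ('X + 1)) ^+ 2 by rewrite /r; ring: two0P.
  have -> : (q \Po ('X + 1)) ^+ 2 = (q ^+ 2) \Po ('X + 1) by rewrite rmorphXn.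
  by rewrite -hq rmorphM /= hh comp_polyD comp_polyX comp_polyC; ring: two0P.
have r0 : r = 0.
  move/(congr1 (@deriv R)): hq; rewrite hr derivM !deriv_sqr mul0r add0r.
  by rewrite derivD derivX derivC addr0 mulr1 => /eqP; rewrite sqrf_eq0 => /eqP.
by move/eqP: hq; rewrite hr r0 expr0n mul0r eq_sym sqrf_eq0 => /eqP.
Qed.

End Char2.

(** * Anisotropy over k[x, z] and k[al, be] *)

(** Here [w] is a primitive cube root of unity. The two variables of
    [{poly {poly k}}] are written x (inner) and z (outer), or al and be when
    they stand for the generators of the biquadratic extension. *)

Section Polynomials.

Variables (k : fieldType) (two0 : 2%:R = 0 :> k) (w : k) (ww : w ^+ 2 = w + 1).

Let two0P : 2%:R = 0 :> {poly k}.
Proof. by rewrite -polyC_natr two0. Qed.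

Let wwP : w%:P ^+ 2 = w%:P + 1 :> {poly k}.
Proof. by rewrite -rmorphXn /= ww rmorphD. Qed.

Lemma w_neq0 : w != 0.
Proof.
by apply/eqP => w0; move/eqP: ww; rewrite w0 expr0n add0r eq_sym oner_eq0.
Qed.

(** The form [phi] below, with denominators cleared. In z its terms in p and r
    have even degree, its terms in q and s odd degree, and in either group the
    leading coefficients cannot cancel because 1 and x are independent over
    the squares of k(x). Hence the leading terms vanish by descent on the
    degree. *)
Lemma phi_poly_anisotropic (p q r s : {poly {poly k}}) :
  'X%:P * p ^+ 2 + 'X%:P * (p * q) + (w%:P * 'X + 1)%:P * ('X * q ^+ 2)
    + ('X ^+ 2)%:P * (r ^+ 2 + r * s + (w%:P)%:P * ('X * s ^+ 2)) = 0 ->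
  [/\ p = 0, q = 0, r = 0 & s = 0].
Proof.
move=> E.
pose N := \max_(t <- [:: p; q; r; s]) size t.
have szN t : t \in [:: p; q; r; s] -> (size t <= N)%N.
  by move=> ts; rewrite /N (big_rem t) //= leq_maxl.
have: [/\ size p <= N.+1, size q <= N, size r <= N.+1 & size s <= N]%N.
  by split; rewrite ?leqW // szN // !inE eqxx ?orbT.
elim: (N) => [|n IHn] [sp sq sr ss].
  move: sq ss; rewrite !size_poly_leq0 => /eqP q0 /eqP s0.
  move: E; rewrite q0 s0 !mulr0 expr0n !mulr0 !addr0 => E.
  suff [p0 r0] : p = 0 /\ r = 0 by [].
  have E0 : p`_0 ^+ 2 + 'X * r`_0 ^+ 2 = 0.
    apply: (mulfI (x := 'X)); first by rewrite polyX_eq0.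
    move/(congr1 (fun p : {poly {poly k}} => p`_(0.*2))): E.
    rewrite coefD !coefCM coef0 !(coef_sqr two0P _ _).1 => E0.
    by rewrite mulr0 -[RHS]E0; ring.
  have [p0 r0] := sqr_indep two0 E0.
  by split; apply/eqP; rewrite -size_poly_leq0; apply: size_leq_pred.
have [pn rn] : p`_n.+1 = 0 /\ r`_n.+1 = 0.
  apply: (sqr_indep two0); apply: (mulfI (x := 'X)); first by rewrite polyX_eq0.
  move/(congr1 (fun p : {poly {poly k}} => p`_(n.+1.*2))): E.
  rewrite !(coefD, coefCM, coefXM) coef0 /= !(coef_sqr two0P _ _).1.
  rewrite !(coef_sqr two0P _ _).2 -addnn !coefM_top ?(leqW sq) ?(leqW ss) //.
  rewrite (nth_default _ sq) (nth_default _ ss) => E0.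
  by rewrite mulr0 -[RHS]E0; ring.
have sp' := size_leq_pred sp pn; have sr' := size_leq_pred sr rn.
apply: IHn.
suff [qn sn] : q`_n = 0 /\ s`_n = 0 by split=> //; apply: size_leq_pred.
(* w is the square of 1 + w *)
have [q1 q2] : q`_n + (1 + w%:P) * 'X * s`_n = 0 /\ (1 + w%:P) * q`_n = 0.
  apply: (sqr_indep two0).
  move/(congr1 (fun p : {poly {poly k}} => p`_(n.*2.+1))): E.
  rewrite !(coefD, coefCM, coefXM) coef0 /= !(coef_sqr two0P _ _).1.
  rewrite !(coef_sqr two0P _ _).2 -addnn -addSn !coefM_top ?(leqW sq) ?(leqW ss) //.
  rewrite (nth_default _ sp') (nth_default _ sr') => E0.
  by rewrite -[RHS]E0; ring: two0P wwP.
have w1 : 1 + w%:P != 0 :> {poly k}.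
  apply/eqP => w1; move/eqP: (wwP); rewrite [X in _ == X]addrC w1.
  by rewrite expf_eq0 polyC_eq0 (negPf w_neq0).
have qn : q`_n = 0 by move/eqP: q2; rewrite mulf_eq0 (negPf w1) => /eqP.
split=> //; move/eqP: q1; rewrite qn add0r !mulf_eq0 (negPf w1) polyX_eq0.
by move/eqP.
Qed.

Definition wpX (R : nzRingType) : {poly R} := 'X^2 + 'X.

Lemma size_wpX (R : nzRingType) : size (wpX R) = 3%N.
Proof. by rewrite /wpX size_polyDl ?size_polyXn ?size_polyX. Qed.

(** The inclusion of k[x, z] in k[al, be] given by x = al^2 + al and
    z = be^2 + be. *)
Definition wp_subst (R : comNzRingType) : {rmorphism {poly {poly R}} -> {poly {poly R}}} :=
  comp_poly (wpX {poly R}) \o map_poly (comp_poly (wpX R)).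

(** The two leading coefficients of (be^2 + be)^n. The second one, n, is what
    makes the parity of the degree matter in [leading_terms]. *)
Lemma coef_wpX_exp (R : comNzRingType) (n : nat) :
  (wpX R ^+ n)`_(n.*2) = 1 /\ (wpX R ^+ n.+1)`_(n.*2.+1) = n.+1%:R.
Proof.
have coefwp (p : {poly R}) i : (wpX R * p)`_i.+2 = p`_i + p`_i.+1.
  by rewrite /wpX mulrDl coefD expr2 -mulrA !coefXM.
elim: n => [|n [IH1 IH2]].
  by rewrite expr0 expr1 coefC /wpX coefD coefXn coefX add0r.
have E : (wpX R ^+ n.+1)`_(n.+1.*2) = 1.
  rewrite exprS doubleS coefwp IH1 nth_default ?addr0 //.
  by rewrite (leq_trans (size_poly_exp_leq _ _)) // size_wpX mul2n.
split; first exact: E.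
by rewrite exprS doubleS coefwp IH2 -doubleS E natr1.
Qed.

Lemma size_wp_subst (R : comNzRingType) (A : {poly {poly R}}) (n : nat) :
  (size A <= n)%N -> (size (wp_subst R A) <= n.*2.-1)%N.
Proof.
move=> sA; have [->|A0] := eqVneq (wp_subst R A) 0; first by rewrite size_poly0.
rewrite (leq_trans (size_comp_poly_leq _ _)) // size_wpX.
have := leq_trans (size_poly _ _) sA : (size (map_poly (comp_poly (wpX R)) A) <= n)%N.
case: n sA => [|n] _.
  rewrite size_poly_leq0 => /eqP mA; move: A0; rewrite /wp_subst /= mA.
  by rewrite comp_poly0 eqxx.
case: (size _) => [|m] //=.
by rewrite ltnS muln2 ltnS leq_double.
Qed.

(** A polynomial of degree n in z has degree 2n in be, and the remainder below
    its leading term has degree at most 2n - 2. Thus its two leading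
    coefficients in be both come from the single leading coefficient in z. *)
Lemma wp_subst_split (R : comNzRingType) (A : {poly {poly R}}) (n : nat) :
  (size A <= n.+1)%N ->
  exists2 B : {poly {poly R}}, (size B <= n.*2.-1)%N
    & wp_subst R A = B + (A`_n \Po wpX R)%:P * wpX {poly R} ^+ n.
Proof.
move=> sA; exists (wp_subst R (take_poly n A)).
  exact/size_wp_subst/size_take_poly.
have dA : drop_poly n A = (A`_n)%:P.
  rewrite [LHS]size1_polyC ?coef_drop_poly ?add0n //.
  by rewrite size_drop_poly leq_subLR addn1.
rewrite -[in LHS](poly_take_drop n A) dA rmorphD rmorphM /=; congr (_ + _).
by rewrite map_polyC /= comp_polyC map_polyXn comp_Xn_poly.
Qed.

Lemma wp_subst_top (R : comNzRingType) (A : {poly {poly R}}) (n : nat) :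
  (size A <= n.+1)%N -> (wp_subst R A)`_(n.*2) = A`_n \Po wpX R.
Proof.
move=> /wp_subst_split[B sB ->]; rewrite coefD coefCM (coef_wpX_exp _ _).1 mulr1.
by rewrite nth_default ?add0r // (leq_trans sB) ?leq_pred.
Qed.

Lemma wp_subst_subtop (R : comNzRingType) (A : {poly {poly R}}) (n : nat) :
  (size A <= n.+2)%N ->
  (wp_subst R A)`_(n.*2.+1) = (A`_n.+1 \Po wpX R) *+ n.+1.
Proof.
move=> /wp_subst_split[B sB ->]; rewrite coefD coefCM (coef_wpX_exp _ _).2.
by rewrite mulr_natr nth_default ?add0r // (leq_trans sB) ?leq_pred.
Qed.

Lemma wpX_shift (h : {poly k}) : (h \Po wpX k) \Po ('X + 1) = h \Po wpX k.
Proof.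
rewrite -comp_polyA; congr (h \Po _).
rewrite /wpX comp_polyD comp_Xn_poly comp_polyX -[RHS]addr0.
by rewrite -(mul0r ('X + 1)) -two0P; ring.
Qed.

Lemma wpX_neq0 : wpX k != 0.
Proof. by rewrite -size_poly_eq0 size_wpX. Qed.

Lemma polyXaddC_eq0 (a : k) : ('X + a%:P == 0) = false.
Proof. by rewrite -size_poly_eq0 size_XaddC. Qed.

(** Elements of k[x] are invariant under al |-> al + 1. The vanishing of all
    leading coefficients below is reduced to this case. *)
Lemma descent_nonsquare (h q : {poly k}) (mu : k) :
  (h \Po wpX k) * ('X + mu%:P) = q ^+ 2 -> q = 0.
Proof. exact/(shift_invariant_nonsquare two0)/wpX_shift. Qed.

Lemma leading_terms_alone (h s : {poly k}) :
  wpX k * (h \Po wpX k) = ('X + w%:P) * (wpX k * s ^+ 2) -> s = 0.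
Proof.
move=> E; have /descent_nonsquare/eqP :
    (h \Po wpX k) * ('X + w%:P) = (('X + w%:P) * s) ^+ 2.
  by apply: (mulfI wpX_neq0); rewrite mulrA E; ring.
by rewrite mulf_eq0 polyXaddC_eq0 => /eqP.
Qed.

(** The equations satisfied by the leading coefficients s and t of S and T in
    [twisted_norm_poly]: h is the leading coefficient of A, and n its degree.
    The second equation either kills t (x s + t) (n even) or forces s (s + t)
    to vanish (n odd); in each of the four cases, h or x h times al + w or
    al + w + 1 is a square. *)
Lemma leading_terms (n : nat) (h s t : {poly k}) :
  wpX k * (h \Po wpX k) = ('X + w%:P) * (wpX k * s ^+ 2 + t ^+ 2) ->
  wpX k * ((h \Po wpX k) *+ n) = ('X + w%:P) * (wpX k * (s * t) + t ^+ 2) ->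
  s = 0 /\ t = 0.
Proof.
set x := wpX k; set h' := h \Po x => E0 E1.
have x0 : x != 0 := wpX_neq0.
(* x + 1 = ('X + w) * ('X + w + 1), because w * (w + 1) = 1 *)
have x1 : x + 1 = ('X + w%:P) * ('X + (w + 1)%:P).
  by rewrite /x /wpX rmorphD /=; ring: two0P wwP.
have x1_neq0 : (x + 1 == 0) = false by rewrite x1 mulf_eq0 !polyXaddC_eq0.
have xh : x * h' = ('X * h) \Po x by rewrite rmorphM /= comp_polyX.
have mod2 : x * (h' *+ n) = x * h' *+ odd n.
  rewrite -{1}(odd_double_half n) -muln2 mulrnDr mulnC mulrnA.
  have -> : h' *+ 2 = 0 by rewrite -mulr_natl two0P mul0r.
  by rewrite mul0rn addr0 mulrnAr.
move: E1; rewrite mod2; case: (odd n) => /= E1.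
  have {E1}: s * (s + t) = 0.
    apply: (mulfI x0); apply: (mulfI (x := 'X + w%:P)); first by rewrite polyXaddC_eq0.
    transitivity (x * h' + x * h'); last by ring: two0P.
    by rewrite {1}E0 -[x * h']mulr1n E1; ring: two0P.
  move/eqP; rewrite mulf_eq0 => /orP[/eqP s0|/eqP/(eq_of_add0 two0P) st].
    split=> //; have /descent_nonsquare/eqP :
        (('X * h) \Po x) * ('X + w%:P) = (('X + w%:P) * t) ^+ 2.
      by rewrite -xh E0 s0; ring.
    by rewrite mulf_eq0 polyXaddC_eq0 => /eqP.
  suff: s = 0 by rewrite -st.
  have /descent_nonsquare/eqP :
      (('X * h) \Po x) * ('X + (w + 1)%:P) = ((x + 1) * s) ^+ 2.
    by rewrite -xh E0 -st exprMn [(x + 1) ^+ 2]expr2 {2}x1; ring.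
  by rewrite mulf_eq0 x1_neq0 => /eqP.
move/esym/eqP: E1; rewrite mulf_eq0 polyXaddC_eq0 /=.
have -> : x * (s * t) + t ^+ 2 = t * (t + x * s) by ring.
rewrite mulf_eq0 => /orP[/eqP t0|/eqP/(eq_of_add0 two0P) tE].
  by split=> //; apply: (leading_terms_alone (h := h)); rewrite -/x -/h' E0 t0; ring.
suff s0 : s = 0 by rewrite tE s0 mulr0.
have /descent_nonsquare/eqP : h' * ('X + (w + 1)%:P) = ((x + 1) * s) ^+ 2.
  apply: (mulfI x0); rewrite mulrA E0 tE [((x + 1) * s) ^+ 2]exprMn.
  by rewrite [(x + 1) ^+ 2]expr2 {2}x1; ring.
by rewrite mulf_eq0 x1_neq0 => /eqP.
Qed.

(** Descent on the degree in be: comparison of the coefficients of be^(2n) and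
    be^(2n-1), where n bounds the degree of S and n - 1 that of T, gives the
    equations of [leading_terms]. *)
Lemma twisted_norm_poly (A S T : {poly {poly k}}) :
  (wpX k)%:P * wp_subst k A =
    ('X + w%:P)%:P * ((wpX k)%:P * (S ^+ 2 + S * T) + wpX {poly k} * T ^+ 2) ->
  S = 0 /\ T = 0.
Proof.
move=> E.
have coefE i : ((wpX k)%:P * wp_subst k A)`_i = ('X + w%:P) *
    (wpX k * ((S ^+ 2)`_i + (S * T)`_i)
     + (('X * ('X * T ^+ 2))`_i + ('X * T ^+ 2)`_i)).
  have wpE : wpX {poly k} * T ^+ 2 = 'X * ('X * T ^+ 2) + 'X * T ^+ 2.
    by rewrite /wpX; ring.
  by rewrite E wpE coefCM coefD coefCM !coefD.
have xcomp (h : {poly k}) : h \Po wpX k = 0 -> h = 0.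
  by move/eqP; rewrite comp_poly_eq0 ?size_wpX // => /eqP.
have evenE m : (size S <= m.+2)%N -> (size T <= m.+1)%N ->
    ((wpX k)%:P * wp_subst k A)`_(m.+1.*2) =
    ('X + w%:P) * (wpX k * S`_m.+1 ^+ 2 + T`_m ^+ 2).
  move=> sS sT; rewrite coefE !coefXM /= !(coef_sqr two0P _ _).1.
  rewrite !(coef_sqr two0P _ _).2 -addnn coefM_top ?(leqW sT) //.
  by rewrite (nth_default _ sT) mulr0 !addr0.
have oddE m : (size S <= m.+2)%N -> (size T <= m.+1)%N ->
    ((wpX k)%:P * wp_subst k A)`_(m.*2.+1) =
    ('X + w%:P) * (wpX k * (S`_m.+1 * T`_m) + T`_m ^+ 2).
  move=> sS sT; rewrite coefE !coefXM /= !(coef_sqr two0P _ _).1.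
  rewrite !(coef_sqr two0P _ _).2 -addnn -addSn coefM_top //.
  case: m {sS sT} => [|m]; rewrite ?addSn /= ?addn0 ?add0r //.
  by rewrite addnS addnn (coef_sqr two0P _ _).2 !add0r.
have sizeA n : (size S <= n.+1)%N -> (size T <= n)%N -> (size A <= n.+1)%N.
  move=> sS sT; case sA: (size A) => [|[|m]] //; rewrite ltnS ltnNge.
  apply/negP => le_nm; have A0 : lead_coef A != 0.
    by rewrite lead_coef_eq0 -size_poly_eq0 sA.
  case/eqP: A0; apply: xcomp; rewrite lead_coefE sA /= -wp_subst_top ?sA //.
  apply: (mulfI wpX_neq0); rewrite -coefCM evenE.
  - by rewrite !nth_default ?expr0n ?mulr0 ?addr0 ?mulr0 // (leq_trans sS, leq_trans sT).
  - by rewrite (leq_trans sS) // ltnS leqW.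
  - by rewrite (leq_trans sT) // leqW.
have: (size T <= maxn (size S) (size T))%N by rewrite leq_maxr.
have: (size S <= (maxn (size S) (size T)).+1)%N by rewrite leqW ?leq_maxl.
elim: (maxn _ _) => [|n IHn] sS sT.
  have T0 : T = 0 by apply/eqP; rewrite -size_poly_leq0.
  split=> //; apply/eqP; rewrite -size_poly_leq0; apply: size_leq_pred => //.
  apply: (leading_terms_alone (h := A`_0)).
  rewrite -wp_subst_top ?sizeA // -coefCM coefE T0 expr0n !mulr0 !coef0 !addr0.
  by rewrite (coef_sqr two0P _ 0).1.
have sA := sizeA _ sS sT.
have [Sn Tn] : S`_n.+1 = 0 /\ T`_n = 0.
  apply: (leading_terms (n := n.+1) (h := A`_n.+1)).
    by rewrite -evenE // coefCM wp_subst_top.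
  by rewrite -oddE // coefCM wp_subst_subtop.
by apply: IHn; apply: size_leq_pred.
Qed.

End Polynomials.

(** * Polynomials in two variables and their values *)

Definition ev2 (k L : comNzRingType) (c : {rmorphism k -> L}) (u v : L) :
    {rmorphism {poly {poly k}} -> L} :=
  horner_eval v \o map_poly (horner_eval u \o map_poly c).

Lemma ev2_inner (k L : comNzRingType) (c : {rmorphism k -> L}) (u v : L)
    (p : {poly k}) : ev2 c u v p%:P = (map_poly c p).[u].
Proof. by rewrite /ev2 /= map_polyC /= /horner_eval hornerC. Qed.

Lemma ev2_const (k L : comNzRingType) (c : {rmorphism k -> L}) (u v : L) (a : k) :
  ev2 c u v (a%:P)%:P = c a.
Proof. by rewrite ev2_inner map_polyC hornerC. Qed.

Lemma ev2_X (k L : comNzRingType) (c : {rmorphism k -> L}) (u v : L) :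
  ev2 c u v 'X%:P = u.
Proof. by rewrite ev2_inner map_polyX hornerX. Qed.

Lemma ev2_Y (k L : comNzRingType) (c : {rmorphism k -> L}) (u v : L) :
  ev2 c u v 'X = v.
Proof. by rewrite /ev2 /= map_polyX /= /horner_eval hornerX. Qed.

Lemma eq_rmorph2 (k L : comNzRingType) (f g : {rmorphism {poly {poly k}} -> L}) :
  (forall a : k, f (a%:P)%:P = g (a%:P)%:P) -> f 'X%:P = g 'X%:P -> f 'X = g 'X ->
  f =1 g.
Proof.
move=> fgC fgX fgY; elim/poly_ind => [|P p IHP]; first by rewrite !rmorph0.
rewrite !(rmorphD, rmorphM) /= IHP fgY; congr (_ + _).
elim/poly_ind: p => [|p a IHp]; first by rewrite !rmorph0.
by rewrite !(rmorphD, rmorphM) /= IHp fgX fgC.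
Qed.

Lemma fractionE (R : idomainType) (e : {fraction R}) :
  exists n d : R, d != 0 /\ e * tofrac d = tofrac n.
Proof.
elim/quotW: e => r; exists \n_r, \d_r; split; first exact: denom_ratioP.
unlock tofrac; rewrite -[LHS]FracField.pi_mul; apply/eqmodP => /=.
rewrite FracField.equivfE /FracField.mulf /= !numden_Ratio ?mulf_neq0 ?mulr1
        ?denom_ratioP ?oner_neq0 //.
by rewrite mulrC.
Qed.

(** This is (a v)^n p(1 / (a v)), as a polynomial in v. With a = x^2 it
    exchanges y and z = 1 / (x^2 y). *)
Definition rev_poly (R : nzRingType) (a : R) (n : nat) (p : {poly R}) : {poly R} :=
  \poly_(i < n.+1) (p`_(n - i) * a ^+ i).

Lemma horner_rev_poly (R L : comNzRingType) (j : {rmorphism R -> L}) (a : R)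
    (u v : L) (n : nat) (p : {poly R}) :
  u * v * j a = 1 -> (size p <= n.+1)%N ->
  (map_poly j p).[u] * (j a * v) ^+ n = (map_poly j (rev_poly a n p)).[v].
Proof.
move=> uva sp.
have smap (q : {poly R}) : (size q <= n.+1 -> size (map_poly j q) <= n.+1)%N.
  exact: leq_trans (size_poly _ _).
rewrite !(horner_coef_wide _ (smap _ _)) ?size_poly //.
rewrite mulr_suml (reindex_inj rev_ord_inj) /=; apply: eq_bigr => i _.
rewrite !coef_map coef_poly ltn_ord /= rmorphM rmorphXn subSS -!mulrA; congr (_ * _).
have le_in : (i <= n)%N by rewrite -ltnS.
have -> : (j a * v) ^+ n = (j a * v) ^+ (n - i) * (j a * v) ^+ i.
  by rewrite -exprD subnK.
rewrite mulrA -!exprMn.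
by rewrite mulrA mulrAC uva expr1n mul1r.
Qed.

Lemma rev_poly_eq0 (R : idomainType) (a : R) (n : nat) (p : {poly R}) :
  a != 0 -> (size p <= n.+1)%N -> rev_poly a n p = 0 -> p = 0.
Proof.
move=> a0 sp r0; apply/polyP => i; rewrite coef0.
have [lt_in|] := ltnP i n.+1; last first.
  by move=> le_ni; rewrite nth_default // (leq_trans sp).
move/(congr1 (fun q : {poly R} => q`_(n - i))): r0.
rewrite coef_poly ltnS leq_subr subKn // coef0 => /eqP.
by rewrite mulf_eq0 expf_eq0 (negPf a0) andbF orbF => /eqP.
Qed.

Lemma constant_form_anisotropic (R : idomainType) (c : R) :
  (forall a b : R, a ^+ 2 + a * b + c * b ^+ 2 = 0 -> a = 0 /\ b = 0) ->
  forall s t : {poly R}, s ^+ 2 + s * t + c%:P * t ^+ 2 = 0 -> s = 0 /\ t = 0.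
Proof.
move=> anis s t E; have: (size t <= maxn (size s) (size t))%N by rewrite leq_maxr.
have: (size s <= maxn (size s) (size t))%N by rewrite leq_maxl.
elim: (maxn _ _) => [|n IHn] ss st.
  by split; apply/eqP; rewrite -size_poly_leq0.
have [sn tn] : s`_n = 0 /\ t`_n = 0.
  apply: anis; move/(congr1 (fun p : {poly R} => p`_(n + n))): E.
  by rewrite coef0 !coefD coefCM !expr2 !coefM_top.
by apply: IHn; apply: size_leq_pred.
Qed.

Lemma wp_homogenize (L : fieldType) (two0 : 2%:R = 0 :> L) (u Z D : L) :
  u ^+ 2 + u = Z -> (u * D) ^+ 2 + u * D * D + Z * D ^+ 2 = 0.
Proof. by move=> <-; ring: two0. Qed.

(** The quadratic form [1, z (w + 1/x)] + x [1, w z] (orthogonal sum). *)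
Definition phi (L : fieldType) (x z w p q r s : L) : L :=
  p ^+ 2 + p * q + z * (w + x^-1) * q ^+ 2 + x * (r ^+ 2 + r * s + w * z * s ^+ 2).

Lemma phi_homogenize (L : fieldType) (x z w p q r s D : L) : x != 0 ->
  phi x z w p q r s = 0 ->
  x * (p * D) ^+ 2 + x * (p * D * (q * D)) + (w * x + 1) * (z * (q * D) ^+ 2)
    + x ^+ 2 * ((r * D) ^+ 2 + r * D * (s * D) + w * (z * (s * D) ^+ 2)) = 0.
Proof.
move=> x0 phi0; transitivity (x * D ^+ 2 * phi x z w p q r s).
  by rewrite /phi; field.
by rewrite phi0 mulr0.
Qed.

(** * The field k(x, y) as the field of fractions of k[x, z] *)

Section RationalFunctions.

Variables (k : fieldType) (two0 : 2%:R = 0 :> k) (w : k) (ww : w ^+ 2 = w + 1).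

Local Notation F := (ratfun2 k).
Local Notation x := (ratx k).
Local Notation y := (raty k).

Definition ratconst : {rmorphism k -> F} :=
  @FracField.tofrac {poly {poly k}} \o polyC \o polyC.

(** With this generator, k(x, y) = k(x, z), and wp^-1(z + 1) generates the same
    extension as wp^-1(z). *)
Definition ratz : F := x ^- 2 * y^-1.

Definition ratev : {rmorphism {poly {poly k}} -> F} := ev2 ratconst x ratz.

Lemma two0F : 2%:R = 0 :> F.
Proof. by rewrite -(rmorph_nat ratconst) two0 rmorph0. Qed.

Lemma ratx_neq0 : x != 0.
Proof. by rewrite /ratx tofrac_eq0 polyC_eq0 polyX_eq0. Qed.

Lemma raty_neq0 : y != 0.
Proof. by rewrite /raty tofrac_eq0 polyX_eq0. Qed.

Lemma tofrac_ev2 (P : {poly {poly k}}) : tofrac P = ev2 ratconst x y P.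
Proof.
apply: eq_rmorph2 => [a||]; first by rewrite ev2_const.
  by rewrite ev2_X.
by rewrite ev2_Y.
Qed.

Local Notation inner := (horner_eval x \o map_poly ratconst : {rmorphism {poly k} -> F}).

Lemma ratz_raty : ratz * y * inner ('X^2) = 1.
Proof.
rewrite /= map_polyXn /horner_eval hornerXn /ratz.
by rewrite mulfVK ?raty_neq0 // mulVf ?expf_neq0 ?ratx_neq0.
Qed.

(** x and z are algebraically independent: multiplication by a power of x^2 y
    turns a polynomial in x and z into one in x and y. *)
Lemma ratev_inj (P : {poly {poly k}}) : ratev P = 0 -> P = 0.
Proof.
move=> P0; have sP := leqSpred (size P).
have X2 : 'X^2 != 0 :> {poly k} by rewrite expf_eq0 polyX_eq0.
apply: (rev_poly_eq0 X2 sP); apply/eqP; rewrite -tofrac_eq0 tofrac_ev2.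
rewrite /ev2 /= /horner_eval -(horner_rev_poly ratz_raty sP).
by move: P0; rewrite /ratev /ev2 /= /horner_eval => ->; rewrite mul0r.
Qed.

Lemma ratev_fraction (e : F) :
  exists A D : {poly {poly k}}, D != 0 /\ e * ratev D = ratev A.
Proof.
have tofracE P : exists A n, tofrac P * ratev (('X^2)%:P * 'X) ^+ n = ratev A.
  have sP := leqSpred (size P); have yz := ratz_raty; rewrite [ratz * y]mulrC in yz.
  exists (rev_poly 'X^2 (size P).-1 P), (size P).-1.
  have -> : ratev (('X^2)%:P * 'X) = inner 'X^2 * ratz.
    by rewrite rmorphM; congr (_ * _); [exact: ev2_inner | exact: ev2_Y].
  rewrite tofrac_ev2.
  by rewrite /ratev /ev2 /= /horner_eval -(horner_rev_poly yz sP).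
have [N [D [D0 eDN]]] := fractionE e.
have [A [n nA]] := tofracE N; have [B [m mB]] := tofracE D.
pose T := ('X^2)%:P * 'X : {poly {poly k}}.
exists (A * T ^+ m), (B * T ^+ n).
have T0 : T != 0 by rewrite mulf_neq0 ?polyC_eq0 ?expf_neq0 ?polyX_eq0.
have B0 : B != 0.
  apply/eqP => B0; move/eqP: mB; rewrite B0 rmorph0 mulf_eq0 tofrac_eq0 (negPf D0).
  by rewrite expf_eq0 => /andP[_ /eqP/ratev_inj/eqP]; rewrite (negPf T0).
split; first by rewrite mulf_neq0 ?expf_neq0.
by rewrite !rmorphM !rmorphXn -nA -mB -eDN !mulrA mulrAC.
Qed.

Lemma common_denominator (s : seq F) : exists2 D : {poly {poly k}},
  D != 0 & forall e, e \in s -> exists A, e * ratev D = ratev A.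
Proof.
elim: s => [|e s [D D0 IHs]]; first by exists 1; rewrite ?oner_eq0.
have [A [B [B0 eB]]] := ratev_fraction e.
exists (D * B) => [|e']; first by rewrite mulf_neq0.
rewrite inE => /orP[/eqP->|/IHs[A' eA']]; rewrite rmorphM.
  by exists (D * A); rewrite mulrCA eB rmorphM.
by exists (A' * B); rewrite mulrA eA' rmorphM.
Qed.

Lemma ratev_neq0 (D : {poly {poly k}}) : D != 0 -> ratev D != 0.
Proof. by move=> D0; apply/eqP => /ratev_inj/eqP; rewrite (negPf D0). Qed.

Lemma not_wp (Z : {poly {poly k}}) :
  (forall s t, s ^+ 2 + s * t + Z * t ^+ 2 = 0 -> s = 0 /\ t = 0) ->
  forall u : F, u ^+ 2 + u <> ratev Z.
Proof.
move=> anis u uZ; have [A [D [D0 uD]]] := ratev_fraction u.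
have [|_ Dz] := anis A D; last by rewrite Dz eqxx in D0.
apply: ratev_inj; rewrite !(rmorphD, rmorphXn, rmorphM) -uD.
by have := wp_homogenize two0F (ratev D) uZ; apply.
Qed.

Lemma ratx_not_wp (u : F) : u ^+ 2 + u <> x.
Proof.
have <- : ratev 'X%:P = x by rewrite /ratev ev2_X.
apply: not_wp; apply: constant_form_anisotropic => a b E.
by apply: (@wp_form_anisotropic _ 0); rewrite addr0.
Qed.

Lemma ratz_not_wp (c : {poly k}) (u : F) : u ^+ 2 + u <> ratz + ratev c%:P.
Proof.
have -> : ratz + ratev c%:P = ratev ('X + c%:P).
  by rewrite rmorphD; congr (_ + _); rewrite /ratev ev2_Y.
exact/not_wp/wp_form_anisotropic.
Qed.

Lemma phi_rat_anisotropic (p q r s : F) :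
  phi x ratz (ratconst w) p q r s = 0 -> [/\ p = 0, q = 0, r = 0 & s = 0].
Proof.
move=> phi0; have [D D0 dD] := common_denominator [:: p; q; r; s].
have [|P pP] := dD p; first by rewrite !inE eqxx.
have [|Q qQ] := dD q; first by rewrite !inE eqxx ?orbT.
have [|R rR] := dD r; first by rewrite !inE eqxx ?orbT.
have [|S sS] := dD s; first by rewrite !inE eqxx ?orbT.
have [] := phi_poly_anisotropic two0 ww (p := P) (q := Q) (r := R) (s := S).
  apply: ratev_inj; have := phi_homogenize (ratev D) ratx_neq0 phi0.
  have ratevx : ratev 'X%:P = x by rewrite /ratev ev2_X.
  have ratevz : ratev 'X = ratz by rewrite /ratev ev2_Y.
  have ratevw : ratev (w%:P)%:P = ratconst w by rewrite /ratev ev2_const.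
  rewrite pP qQ rR sS -{1 2 3 4}ratevx -ratevz -ratevw.
  by rewrite !(rmorphD, rmorphXn, rmorphM, rmorph1).
have zero (e : F) A : e * ratev D = ratev A -> A = 0 -> e = 0.
  move=> eA A0; move/eqP: eA; rewrite A0 rmorph0 mulf_eq0.
  by rewrite (negPf (ratev_neq0 D0)) orbF => /eqP.
by move=> /(zero _ _ pP) -> /(zero _ _ qQ) -> /(zero _ _ rR) -> /(zero _ _ sS) ->.
Qed.

End RationalFunctions.

Lemma wp_of_affine (L : fieldType) (two0 : 2%:R = 0 :> L) (al be x z u v : L) :
  al ^+ 2 + al = x -> be ^+ 2 + be = z -> be = u + v * al ->
  (u ^+ 2 + u + v ^+ 2 * x + z) + (v ^+ 2 + v) * al = 0.
Proof. by move=> <- <- ->; ring: two0. Qed.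

(** The polynomials of this form contain the constants and are stable under
    sums and under multiplication by al and be, as al^2 = x - al and
    be^2 = z - be. *)
Lemma wp_subst_decomp (k : comNzRingType) (P : {poly {poly k}}) :
  exists A B C D, P = wp_subst k A + wp_subst k B * 'X%:P
                    + (wp_subst k C + wp_subst k D * 'X%:P) * 'X.
Proof.
pose W := wp_subst k.
have WX : W 'X%:P = 'X%:P ^+ 2 + 'X%:P.
  by rewrite /W /wp_subst /= map_polyC /= comp_polyC comp_polyX /wpX rmorphD rmorphXn.
have WY : W 'X = 'X ^+ 2 + 'X by rewrite /W /wp_subst /= map_polyX comp_polyX.
have WC a : W (a%:P)%:P = (a%:P)%:P.
  by rewrite /W /wp_subst /= map_polyC /= !comp_polyC.
pose G Q := exists A B C D, Q = W A + W B * 'X%:P + (W C + W D * 'X%:P) * 'X.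
have GX Q : G Q -> G (Q * 'X%:P).
  move=> [A [B [C [D ->]]]].
  exists (B * 'X%:P), (A - B), (D * 'X%:P), (C - D).
  rewrite !(rmorphM, rmorphB) WX; move: (W A) (W B) (W C) (W D) => *; ring.
have GY Q : G Q -> G (Q * 'X).
  move=> [A [B [C [D ->]]]].
  exists (C * 'X), (D * 'X), (A - C), (B - D).
  rewrite !(rmorphM, rmorphB) WY; move: (W A) (W B) (W C) (W D) => *; ring.
have GD Q R : G Q -> G R -> G (Q + R).
  move=> [A [B [C [D ->]]]] [A' [B' [C' [D' ->]]]].
  exists (A + A'), (B + B'), (C + C'), (D + D'); rewrite !rmorphD.
  move: (W A) (W B) (W C) (W D) (W A') (W B') (W C') (W D') => *; ring.
have GC a : G (a%:P)%:P.
  by exists (a%:P)%:P, 0, 0, 0; rewrite WC !rmorph0 !mul0r !addr0 mul0r addr0.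
suff GP p : G p%:P.
  elim/poly_ind: P => [|P p IHP]; first by rewrite -polyC0; apply: GP.
  by apply: GD; [apply: GY | apply: GP].
elim/poly_ind: p => [|p a IHp]; first by rewrite -polyC0; apply: GC.
by rewrite polyCD polyCM; apply: GD => //; apply: GX.
Qed.

Lemma basis4_scale (L : fieldType) (al be a b c e d : L) :
  (a + b * al + (c + e * al) * be) * d =
    a * d + b * d * al + (c * d + e * d * al) * be.
Proof. by ring. Qed.

Lemma twisted_norm_clear (L : fieldType) (al w x z s t f D : L) : x != 0 ->
  (al + w) * (s ^+ 2 + s * t + z / x * t ^+ 2) = f ->
  x * (f * D * D) =
    (al + w) * (x * ((s * D) ^+ 2 + s * D * (t * D)) + z * (t * D) ^+ 2).
Proof. by move=> x0 <-; field. Qed.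

(** * The biquadratic extension as the field k(al, be) *)

Section Biquadratic.

Variables (k : fieldType) (two0 : 2%:R = 0 :> k) (w : k) (ww : w ^+ 2 = w + 1).

Local Notation F := (ratfun2 k).

Variables (K : fieldExtType (ratfun2 k)) (al be : K).
Hypothesis al_wp : al ^+ 2 + al = in_alg K (ratx k).
Hypothesis be_wp : be ^+ 2 + be = in_alg K (ratz k).

Lemma two0K : 2%:R = 0 :> K.
Proof. by rewrite -(rmorph_nat (in_alg K)) two0F // rmorph0. Qed.

Lemma in_algP (v : K) : v \in 1%VS -> exists f : F, v = in_alg K f.
Proof. by move/vlineP => [f ->]; exists f. Qed.

Lemma al_notin : al \notin 1%VS.
Proof.
apply/negP => /in_algP[u alu]; apply: (ratx_not_wp two0 (u := u)).
by have := al_wp; rewrite alu -rmorphXn -rmorphD => /fmorph_inj.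
Qed.

Lemma wp_degree_le2 (E : {subfield K}) (v e : K) :
  v ^+ 2 + v = e -> e \in E -> (adjoin_degree E v <= 2)%N.
Proof.
move=> ve eE; rewrite leqNgt; apply/negP => deg.
have sz : size ('X^2 + 'X - e%:P) = 3%N.
  by rewrite -addrA size_polyDl size_polyXn // size_XsubC.
have pE : 'X^2 + 'X - e%:P \is a polyOver E.
  by rewrite rpredB ?rpredD ?rpredX ?polyOverX ?polyOverC.
have := root_small_adjoin_poly (x := v) pE; rewrite sz => /(_ deg).
by rewrite -size_poly_eq0 sz /root !hornerE ve subrr eqxx.
Qed.

Lemma in_adjoin_wp (E : {subfield K}) (v e c : K) :
  v ^+ 2 + v = e -> e \in E -> c \in <<E; v>>%VS ->
  exists f g : K, [/\ f \in E, g \in E & c = f + g * v].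
Proof.
move=> ve eE /Fadjoin_poly_eq cE.
have /polyOverP FE := Fadjoin_polyOver E v c.
exists (Fadjoin_poly E v c)`_0, (Fadjoin_poly E v c)`_1; split=> //.
rewrite -{1}cE (@horner_coef_wide _ 2).
  by rewrite !big_ord_recl big_ord0 expr0 mulr1 expr1 addr0.
exact: leq_trans (size_Fadjoin_poly _ _ _) (wp_degree_le2 ve eE).
Qed.

Lemma in_adjoin_al (c : K) : c \in <<1; al>>%VS ->
  exists f g : F, c = in_alg K f + in_alg K g * al.
Proof.
move=> /(in_adjoin_wp (E := 1%AS) al_wp (memvZ _ (mem1v _))).
by move=> [f [g [/in_algP[f' ->] /in_algP[g' ->] ->]]]; exists f', g'.
Qed.

Lemma free_over (E : {subfield K}) (v a b : K) :
  v \notin E -> a \in E -> b \in E -> a + b * v = 0 -> a = 0 /\ b = 0.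
Proof.
move=> vE aE bE ab0; have b0 : b = 0.
  apply/eqP/(contraR _ vE) => b0.
  have -> : v = - a / b.
    by apply: (mulIf b0); rewrite divfK // mulrC; apply/eqP; rewrite -subr_eq0 opprK addrC ab0.
  by rewrite rpred_div ?rpredN.
by split=> //; move: ab0; rewrite b0 mul0r addr0.
Qed.

Lemma in_alg_mem (f : F) (E : {subfield K}) : in_alg K f \in E.
Proof. by rewrite rpredZ ?rpred1. Qed.

(** If be = u + v al with u, v in F, then v is 0 or 1, so z or z + x would be of
    the form u^2 + u, which the degree in z forbids. *)
Lemma be_notin : be \notin <<1; al>>%VS.
Proof.
apply/negP => /in_adjoin_al[u [v beE]].
have := wp_of_affine two0K al_wp be_wp beE.
rewrite -!rmorphXn -!rmorphM -!rmorphD.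
move=> /(free_over al_notin (in_alg_mem _ _) (in_alg_mem _ _))[].
have inj (f : F) : in_alg K f = 0 -> f = 0.
  by move=> f0; apply: (fmorph_inj (in_alg K)); rewrite rmorph0.
move=> /inj uE /inj vE.
have [c vc] : exists c : {poly k}, v ^+ 2 * ratx k = ratev k c%:P.
  move/eqP: vE; rewrite -{2}[v]mulr1 expr2 -mulrDr mulf_eq0 => /orP[/eqP->|].
    by exists 0; rewrite !mul0r rmorph0.
  move/eqP/(eq_of_add0 (two0F two0)) => ->; exists 'X.
  by rewrite !mul1r /ratev ev2_X.
apply: (ratz_not_wp two0 (c := c) (u := u)); apply: (eq_of_add0 (two0F two0)).
by rewrite -vc addrA addrAC.
Qed.

Lemma dim_K : <<1 & [:: al; be]>>%VS = {:K}%VS -> \dim {:K} = 4%N.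
Proof.
have deg2 (E : {subfield K}) v e : v ^+ 2 + v = e -> e \in E -> v \notin E ->
    adjoin_degree E v = 2%N.
  move=> ve eE vE; apply/eqP; rewrite eqn_leq (wp_degree_le2 ve eE) ltn_neqAle /=.
  by rewrite eq_sym adjoin_deg_eq1 vE.
rewrite adjoin_cons adjoin_seq1 => <-.
rewrite dim_Fadjoin (deg2 _ _ _ be_wp (in_alg_mem _ _) be_notin) dim_Fadjoin.
by rewrite (deg2 1%AS _ _ al_wp (in_alg_mem _ _) al_notin) dimv1.
Qed.

Definition basis4 (f1 f2 f3 f4 : F) : K :=
  in_alg K f1 + in_alg K f2 * al + (in_alg K f3 + in_alg K f4 * al) * be.

Lemma basis4_span : <<1 & [:: al; be]>>%VS = {:K}%VS ->
  forall c : K, exists f1 f2 f3 f4, c = basis4 f1 f2 f3 f4.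
Proof.
rewrite adjoin_cons adjoin_seq1 => gen c.
have : c \in <<<<1; al>>; be>>%VS by rewrite gen memvf.
move=> /(in_adjoin_wp be_wp (in_alg_mem _ _))[f [g [fE gE ->]]].
move/in_adjoin_al: fE => [f1 [f2 ->]]; move/in_adjoin_al: gE => [f3 [f4 ->]].
by exists f1, f2, f3, f4.
Qed.

Lemma basis4_free (f1 f2 f3 f4 : F) :
  basis4 f1 f2 f3 f4 = 0 -> [/\ f1 = 0, f2 = 0, f3 = 0 & f4 = 0].
Proof.
have linE (f g : F) : in_alg K f + in_alg K g * al \in <<1; al>>%VS.
  by rewrite rpredD ?rpredM ?memv_adjoin ?in_alg_mem.
have inj (f g : F) : in_alg K f + in_alg K g * al = 0 -> f = 0 /\ g = 0.
  move=> /(free_over al_notin (in_alg_mem _ _) (in_alg_mem _ _))[f0 g0].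
  by split; apply: (fmorph_inj (in_alg K)); rewrite rmorph0.
by move=> /(free_over be_notin (linE _ _) (linE _ _))[/inj[-> ->] /inj[-> ->]].
Qed.

Definition evK : {rmorphism {poly {poly k}} -> K} :=
  ev2 (in_alg K \o ratconst k) al be.

Lemma evK_wp_subst (P : {poly {poly k}}) :
  evK (wp_subst k P) = in_alg K (ratev k P).
Proof.
pose f : {rmorphism {poly {poly k}} -> K} := evK \o wp_subst k.
pose g : {rmorphism {poly {poly k}} -> K} := in_alg K \o ratev k.
have fC a : f (a%:P)%:P = evK (a%:P)%:P.
  by rewrite /f /wp_subst /= map_polyC /= !comp_polyC.
have fX : f 'X%:P = evK (wpX k)%:P.
  by rewrite /f /wp_subst /= map_polyC /= comp_polyC comp_polyX.
have fY : f 'X = evK (wpX {poly k}).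
  by rewrite /f /wp_subst /= map_polyX comp_polyX.
have gE Q : g Q = in_alg K (ratev k Q) by [].
have wpv (u : {poly {poly k}}) v : evK u = v -> evK (u ^+ 2 + u) = v ^+ 2 + v.
  by move=> uv; rewrite rmorphD rmorphXn uv.
apply: (eq_rmorph2 (f := f) (g := g)) => [a||].
- by rewrite fC gE /ratev /evK !ev2_const.
- rewrite fX gE /ratev ev2_X -al_wp /wpX rmorphD rmorphXn; apply: wpv.
  exact: ev2_X.
- by rewrite fY gE /ratev ev2_Y -be_wp; apply: wpv; exact: ev2_Y.
Qed.

Lemma evK_basis4 (A B C D : {poly {poly k}}) :
  evK (wp_subst k A + wp_subst k B * 'X%:P
       + (wp_subst k C + wp_subst k D * 'X%:P) * 'X) =
  basis4 (ratev k A) (ratev k B) (ratev k C) (ratev k D).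
Proof.
have evX : evK 'X%:P = al by exact: ev2_X.
have evY : evK 'X = be by exact: ev2_Y.
rewrite !(rmorphD evK) !(rmorphM evK) evX evY !(rmorphD evK) !(rmorphM evK) evX.
by congr (_ + _ * _ + (_ + _ * _) * _); exact: evK_wp_subst.
Qed.

(** al and be are algebraically independent over k: a polynomial in them is a
    combination of 1, al, be and al be with coefficients in k[x, z]. *)
Lemma evK_inj (P : {poly {poly k}}) : evK P = 0 -> P = 0.
Proof.
have [A [B [C [D ->]]]] := wp_subst_decomp P.
rewrite evK_basis4 => /basis4_free[].
by do 4![move/ratev_inj->]; rewrite !rmorph0 !mul0r !addr0 mul0r addr0.
Qed.

Lemma evK_inj2 (P Q : {poly {poly k}}) : evK P = evK Q -> P = Q.
Proof.
move=> PQ; apply/eqP; rewrite -subr_eq0; apply/eqP/evK_inj.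
by rewrite (rmorphB evK) PQ subrr.
Qed.

Lemma basis4_clear (f1 f2 f3 f4 d a1 a2 a3 a4 : F) :
  f1 * d = a1 -> f2 * d = a2 -> f3 * d = a3 -> f4 * d = a4 ->
  basis4 f1 f2 f3 f4 * in_alg K d = basis4 a1 a2 a3 a4.
Proof.
move=> <- <- <- <-; rewrite /basis4 !(rmorphM (in_alg K)).
exact: basis4_scale.
Qed.

(** Denominators can be taken in k[x, z], because K is spanned over F by 1, al,
    be and al be. Clearing them multiplies the value by an element of F, which
    preserves the shape of the equation and reduces it to
    [twisted_norm_poly]. *)
Lemma twisted_norm (f : F) (s t : K) : <<1 & [:: al; be]>>%VS = {:K}%VS ->
  (al + in_alg K (ratconst k w)) *
    (s ^+ 2 + s * t + in_alg K (ratz k) / in_alg K (ratx k) * t ^+ 2) = in_alg K f ->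
  s = 0 /\ t = 0.
Proof.
move=> gen E.
have [s1 [s2 [s3 [s4 sE]]]] := basis4_span gen s.
have [t1 [t2 [t3 [t4 tE]]]] := basis4_span gen t.
have [D D0 dD] := common_denominator [:: f; s1; s2; s3; s4; t1; t2; t3; t4].
have [|A fA] := dD f; first by rewrite mem_head.
have polyE (c : K) c1 c2 c3 c4 : c = basis4 c1 c2 c3 c4 ->
    {subset [:: c1; c2; c3; c4] <= [:: f; s1; s2; s3; s4; t1; t2; t3; t4]} ->
    exists C, c * in_alg K (ratev k D) = evK C.
  move=> -> sub; have [|C1 c1E] := dD c1; first by rewrite sub // !inE eqxx.
  have [|C2 c2E] := dD c2; first by rewrite sub // !inE eqxx ?orbT.
  have [|C3 c3E] := dD c3; first by rewrite sub // !inE eqxx ?orbT.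
  have [|C4 c4E] := dD c4; first by rewrite sub // !inE eqxx ?orbT.
  by rewrite (basis4_clear c1E c2E c3E c4E) -evK_basis4; eexists.
have [|S sS] := polyE s _ _ _ _ sE.
  by move=> c; rewrite !inE => /or4P[]/eqP->; rewrite eqxx ?orbT.
have [|T tT] := polyE t _ _ _ _ tE.
  by move=> c; rewrite !inE => /or4P[]/eqP->; rewrite eqxx ?orbT.
have d0 : in_alg K (ratev k D) != 0 by rewrite fmorph_eq0 ratev_neq0.
have x0 : in_alg K (ratx k) != 0 by rewrite fmorph_eq0 ratx_neq0.
have [S0 T0] : S = 0 /\ T = 0.
  apply: (twisted_norm_poly two0 ww (A := A * D)); apply: evK_inj2.
  have evwpX : evK (wpX k)%:P = in_alg K (ratx k).
    have -> : (wpX k)%:P = wp_subst k 'X%:P.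
      by rewrite /wp_subst /= map_polyC /= comp_polyC comp_polyX.
    by rewrite evK_wp_subst /ratev ev2_X.
  have evwpY : evK (wpX {poly k}) = in_alg K (ratz k).
    have -> : wpX {poly k} = wp_subst k 'X.
      by rewrite /wp_subst /= map_polyX comp_polyX.
    by rewrite evK_wp_subst /ratev ev2_Y.
  have evXw : evK ('X + w%:P)%:P = al + in_alg K (ratconst k w).
    rewrite polyCD (rmorphD evK); congr (_ + _); first exact: ev2_X.
    exact: ev2_const.
  transitivity (in_alg K (ratx k) *
      (in_alg K f * in_alg K (ratev k D) * in_alg K (ratev k D))).
    rewrite (rmorphM evK) evwpX evK_wp_subst; congr (_ * _).
    by rewrite (rmorphM (ratev k)) -fA !(rmorphM (in_alg K)).
  rewrite (twisted_norm_clear (in_alg K (ratev k D)) x0 E) sS tT.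
  rewrite (rmorphM evK) evXw (rmorphD evK) (rmorphM evK) evwpX; congr (_ * (_ * _ + _)).
    by rewrite (rmorphD evK) (rmorphXn evK) (rmorphM evK).
  by rewrite (rmorphM evK) evwpY (rmorphXn evK).
split; apply/eqP; [move/eqP: sS; rewrite S0|move/eqP: tT; rewrite T0].
  by rewrite rmorph0 mulf_eq0 (negPf d0) orbF.
by rewrite rmorph0 mulf_eq0 (negPf d0) orbF.
Qed.

End Biquadratic.

(** * Quadratic forms: planes on which the form is a single square *)

Section QuadraticForms.

Variable L : fieldType.

Definition polar (n : nat) (M : 'M[L]_n) (u v : 'rV[L]_n) : L :=
  (u *m (M + M^T) *m v^T) 0 0.

Lemma qformD (n : nat) (M : 'M[L]_n) (u v : 'rV[L]_n) :
  qform M (u + v) = qform M u + qform M v + polar M u v.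
Proof.
have vMu : (v *m M *m u^T) 0 0 = (u *m M^T *m v^T) 0 0.
  by rewrite -[in RHS](trmxK u) -2!trmx_mul mulmxA [RHS]mxE.
have tr : (u + v)^T = u^T + v^T by rewrite linearD.
rewrite /qform /polar tr mulmxDr !mulmxDl !mulmxDr !mulmxDl ![((_ + _)%R : 'M_1) _ _]mxE vMu.
by ring.
Qed.

Lemma qformZ (n : nat) (M : 'M[L]_n) (a : L) (u : 'rV[L]_n) :
  qform M (a *: u) = a ^+ 2 * qform M u.
Proof. by rewrite /qform linearZ /= -!scalemxAl -scalemxAr !mxE mulrA -expr2. Qed.

Lemma qform0 (n : nat) (M : 'M[L]_n) : qform M 0 = 0.
Proof. by rewrite /qform !mul0mx mxE. Qed.

Lemma polarC (n : nat) (M : 'M[L]_n) (u v : 'rV[L]_n) : polar M u v = polar M v u.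
Proof.
apply: (addrI (qform M u + qform M v)).
by rewrite -qformD addrC qformD [qform M v + _]addrC.
Qed.

Lemma polar_lin (n : nat) (M : 'M[L]_n) (a b : L) (u u' v : 'rV[L]_n) :
  polar M (a *: u + b *: u') v = a * polar M u v + b * polar M u' v.
Proof. by rewrite /polar !mulmxDl -!scalemxAl !mxE. Qed.

Lemma polar_self (n : nat) (M : 'M[L]_n) (u : 'rV[L]_n) :
  2%:R = 0 :> L -> polar M u u = 0.
Proof.
move=> two0; apply: (addrI (qform M u + qform M u)); rewrite -qformD addr0.
have -> : u + u = 2%:R *: u by rewrite scaler_nat mulr2n.
by rewrite two0 qformZ expr0n mul0r -mulr2n -mulr_natl two0 mul0r.
Qed.

(** f and g span a plane on which the form is b ^+ 2 * e, with b the coordinate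
    along g: f is isotropic and orthogonal to g, which has value e. *)
Definition plane_of_value (n : nat) (M : 'M[L]_n) (e : L) (f g : 'rV[L]_n) : Prop :=
  (forall a b : L, a *: f + b *: g = 0 -> a = 0 /\ b = 0) /\
  (forall a b : L, qform M (a *: f + b *: g) = b ^+ 2 * e).

(** Suppose that h0 is the only line of its orthogonal complement on which the
    form takes values in V, and likewise for h1. Every plane meets the
    complement of h0 nontrivially. On a plane of value e in V, scaling by
    the inverse of b turns the value of the common vector into e (or 0), so
    this vector is a multiple of h0. Thus the plane contains h0, and likewise
    h1. But the polar form vanishes on the plane, whereas h0 and h1 are not
    orthogonal. *)
Lemma no_plane_of_value (two0 : 2%:R = 0 :> L) (n : nat) (M : 'M[L]_n)
    (V : L -> Prop) (h0 h1 : 'rV[L]_n) :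
  V 0 -> polar M h0 h1 != 0 ->
  (forall v, polar M v h0 = 0 -> V (qform M v) -> exists c, v = c *: h0) ->
  (forall v, polar M v h1 = 0 -> V (qform M v) -> exists c, v = c *: h1) ->
  forall e f g, V e -> ~ plane_of_value M e f g.
Proof.
move=> V0 h01 perp0 perp1 e f g Ve [free val].
have fg0 : polar M f g = 0.
  have := val 1 1; rewrite !scale1r qformD.
  have := val 1 0; rewrite scale1r scale0r addr0 => ->.
  have := val 0 1; rewrite scale1r scale0r add0r => ->.
  by rewrite expr0n mul0r add0r expr1n mul1r => /(canRL (addKr _)); rewrite addNr.
have span h : (forall v, polar M v h = 0 -> V (qform M v) -> exists c, v = c *: h) ->
    exists a b, h = a *: f + b *: g.
  move=> perp.
  have [a [b [ab abh]]] : exists a b, (a, b) != (0, 0) /\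
      polar M (a *: f + b *: g) h = 0.
    have [fh|fh] := eqVneq (polar M f h) 0.
      exists 1, 0; split; first by rewrite xpair_eqE oner_eq0.
      by rewrite polar_lin fh mulr0 mul0r addr0.
    exists (polar M g h), (- polar M f h); split.
      by rewrite xpair_eqE negb_and oppr_eq0 fh orbT.
    by rewrite polar_lin mulNr mulrC subrr.
  have [c vc] : exists c, a *: f + b *: g = c *: h.
    have [b0|b0] := eqVneq b 0.
      by apply: perp => //; rewrite val b0 expr0n mul0r.
    have [||c cE] := perp (b^-1 *: (a *: f + b *: g)).
    - have := polar_lin M b^-1 0 (a *: f + b *: g) 0 h.
      by rewrite scaler0 addr0 abh mulr0 mul0r addr0.
    - by rewrite qformZ val mulrA -exprMn mulVf // expr1n mul1r.
    by exists (b * c); rewrite -scalerA -cE scalerA mulfV // scale1r.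
  have c0 : c != 0.
    apply: contraNneq ab => c0; move: vc; rewrite c0 scale0r => /free[-> ->].
    exact: eqxx.
  exists (c^-1 * a), (c^-1 * b).
  by rewrite -!scalerA -scalerDr vc scalerA mulVf // scale1r.
have [a0 [b0 h0E]] := span _ perp0; have [a1 [b1 h1E]] := span _ perp1.
case/eqP: h01; rewrite h0E h1E polar_lin [polar M f _]polarC [polar M g _]polarC.
rewrite !polar_lin !(polar_self _ _ two0) [polar M g f]polarC fg0.
by rewrite !mulr0 !addr0 !mulr0 addr0.
Qed.

Lemma qform_qsum (m n : nat) (A : 'M[L]_m) (B : 'M[L]_n) (u : 'rV[L]_m) (v : 'rV[L]_n) :
  qform (qsum A B) (row_mx u v) = qform A u + qform B v.
Proof.
rewrite /qform /qsum mul_row_block !mulmx0 addr0 add0r tr_row_mx mul_row_col.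
by rewrite mxE.
Qed.

Lemma qform_qbin (a b p q : L) :
  qform (qbin a b) (row_mx p%:M q%:M) = a * p ^+ 2 + p * q + b * q ^+ 2.
Proof.
rewrite /qform /qbin mul_row_block tr_row_mx mul_row_col.
by rewrite !(mxE, big_ord1) /= !mulr1n; ring.
Qed.

Lemma qform_qmult (i n : nat) (A : 'M[L]_n) (u : 'I_i -> 'rV[L]_n) :
  qform (qmult i A) (\mxrow_l u l) = \sum_l qform A (u l).
Proof.
rewrite /qform /qmult mul_mxrow_mxdiag tr_mxrow mul_mxrow_mxcol summxE.
by [].
Qed.

Lemma isometric_dim (m n : nat) (A : 'M[L]_m) (B : 'M[L]_n) : isometric A B -> m = n.
Proof.
move=> [P [Q [PQ QP _]]]; apply/eqP.
by rewrite eqn_leq (mulmx1_min PQ) (mulmx1_min QP).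
Qed.

Lemma isometric_sym (m n : nat) (A : 'M[L]_m) (B : 'M[L]_n) :
  isometric A B -> isometric B A.
Proof.
move=> [P [Q [PQ QP AB]]]; exists Q, P; split=> // v.
by rewrite -AB -mulmxA QP mulmx1.
Qed.

Lemma isometry_inj (m n : nat) (P : 'M[L]_(m, n)) (Q : 'M[L]_(n, m)) (v : 'rV[L]_m) :
  P *m Q = 1%:M -> v *m P = 0 -> v = 0.
Proof. by move=> PQ vP; rewrite -[v]mulmx1 -PQ mulmxA vP mul0mx. Qed.

Lemma isometric_plane (m n : nat) (A : 'M[L]_m) (B : 'M[L]_n) (e : L) (f g : 'rV[L]_m) :
  isometric A B -> plane_of_value A e f g ->
  exists f' g', plane_of_value B e f' g'.
Proof.
move=> [P [Q [PQ _ AB]]] [free val]; exists (f *m P), (g *m P).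
split=> a b; rewrite !scalemxAl -mulmxDl ?AB //.
by move/(isometry_inj PQ)/free.
Qed.

(** The vector with coordinates (c l, 0) in the l-th hyperbolic plane; these
    form a totally isotropic subspace. *)
Definition hyp_vec (i : nat) (c : 'I_i -> L) : 'rV[L]_(\sum_(l < i) (1 + 1)) :=
  \mxrow_l row_mx (c l)%:M 0%:M.

Lemma qform_hyp_vec (i : nat) (c : 'I_i -> L) : qform (qmult i (qbin 0 0)) (hyp_vec c) = 0.
Proof.
rewrite qform_qmult big1 // => l _.
by rewrite qform_qbin expr0n !(mul0r, mulr0) !addr0.
Qed.

Lemma hyp_vec_lin (i : nat) (a b : L) (c d : 'I_i -> L) :
  a *: hyp_vec c + b *: hyp_vec d = hyp_vec (fun l => a * c l + b * d l).
Proof.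
rewrite /hyp_vec; apply/rowP => j; rewrite !mxE.
by case: (split _) => u; rewrite !mxE !mulrnAr -mulrnDl // !mulr0 addr0.
Qed.

Lemma hyp_vec_eq0 (i : nat) (c : 'I_i -> L) (l : 'I_i) : hyp_vec c = 0 -> c l = 0.
Proof.
move/(congr1 (fun u => submxrow u l)); rewrite mxrowK => /rowP/(_ ord0).
rewrite submxrow0 !mxE; case: splitP => // j _.
by rewrite mxE (ord1 j) mulr1n.
Qed.

Lemma rV_dim0 (n : nat) (v : 'rV[L]_n) : n = 0%N -> v = 0.
Proof. by move=> n0; apply/rowP => -[j lt_j]; exfalso; move: lt_j; rewrite n0. Qed.

Lemma embed_lin (n1 n2 n3 : nat) (a b : L) (u u' : 'rV[L]_n1) (v v' : 'rV[L]_n2)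
    (t t' : 'rV[L]_n3) :
  a *: row_mx (row_mx u v) t + b *: row_mx (row_mx u' v') t' =
  row_mx (row_mx (a *: u + b *: u') (a *: v + b *: v')) (a *: t + b *: t').
Proof. by rewrite !scale_row_mx !add_row_mx. Qed.

Lemma hyperbolic_plane (i j p : nat) (C : 'M[L]_p) : (1 < i)%N ->
  exists f g, plane_of_value
    (qsum (qsum (qmult i (qbin 0 0)) (qmult j (qdiag1 0))) C) 0 f g.
Proof.
move=> lt1i; pose i0 := Ordinal (ltnW lt1i); pose i1 := Ordinal lt1i.
pose f := hyp_vec (fun l => (l == i0)%:R); pose g := hyp_vec (fun l => (l == i1)%:R).
exists (row_mx (row_mx f 0) 0), (row_mx (row_mx g 0) 0).
split=> a b; rewrite embed_lin !scaler0 !addr0 hyp_vec_lin.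
  rewrite -[0 in RHS]row_mx0 => /eq_row_mx[]; rewrite -[0 in RHS]row_mx0 => /eq_row_mx[h _] _.
  have := hyp_vec_eq0 i0 h; have := hyp_vec_eq0 i1 h; rewrite !eqxx /=.
  by rewrite !mulr0 !mulr1 addr0 add0r => -> ->.
by rewrite !qform_qsum qform_hyp_vec !qform0 mulr0 !addr0.
Qed.

Lemma mixed_plane (i j p : nat) (C : 'M[L]_p) (c : 'rV[L]_p) : (0 < i)%N -> c != 0 ->
  exists f g, plane_of_value
    (qsum (qsum (qmult i (qbin 0 0)) (qmult j (qdiag1 0))) C) (qform C c) f g.
Proof.
move=> lt0i c0; pose i0 := Ordinal lt0i.
pose f := hyp_vec (fun l => (l == i0)%:R).
exists (row_mx (row_mx f 0) 0), (row_mx (row_mx (hyp_vec (fun=> 0)) 0) c).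
split=> a b; rewrite embed_lin !scaler0 !addr0 ?add0r hyp_vec_lin.
  rewrite -[0 in RHS]row_mx0 => /eq_row_mx[]; rewrite -[0 in RHS]row_mx0 => /eq_row_mx[h _] /eqP.
  rewrite scaler_eq0 (negPf c0) orbF => /eqP b0; split=> //.
  by have := hyp_vec_eq0 i0 h; rewrite eqxx mulr1 mulr0 addr0.
by rewrite !qform_qsum qform_hyp_vec !qform0 qformZ !add0r.
Qed.

End QuadraticForms.

Lemma qform_zeros (L : fieldType) (j : nat) (u : 'rV[L]_(\sum_(l < j) 1)) :
  qform (qmult j (qdiag1 0)) u = 0.
Proof.
rewrite -[u]submxrowK qform_qmult big1 // => l _.
by rewrite /qform /qdiag1 scalar_mxC mul_scalar_mx scale0r mul0mx mxE.
Qed.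

Lemma qform_ext (F K : fieldType) (i : {rmorphism F -> K}) (n : nat) (A : 'M[F]_n)
    (v : 'rV[F]_n) : qform (qext i A) (map_mx i v) = i (qform A v).
Proof. by rewrite /qform /qext map_trmx -!map_mxM mxE. Qed.

(** If the anisotropic part of a nondegenerate isotropic form M of dimension 4 is
    defined over F, then M has a plane whose value is in F. With Witt index at
    least 2, a totally isotropic plane will do. With Witt index 1, the
    anisotropic part has dimension 2, and a plane is spanned by an isotropic
    vector of the hyperbolic part and a vector coming from F. This replaces the
    uniqueness of the anisotropic part. *)
Lemma defined_anisotropic_part_plane (F K : fieldType) (i : {rmorphism F -> K})
    (M : 'M[K]_4) (m : nat) (B : 'M[F]_m) (p : nat) (C : 'M[K]_p) :
  (forall v, (forall u, polar M u v = 0) -> v = 0) -> isotropic M ->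
  anisotropic_part M C -> isometric C (qext i B) ->
  exists e f g, plane_of_value M (i e) f g.
Proof.
move=> nondeg [v0 v0_neq0 Mv0] [aniC [h [j isoM]]] isoC.
have [P [Q [PQ QP MS]]] := isoM.
set S := qsum _ C in isoM MS.
have QM v : qform M (v *m Q) = qform S v by rewrite -MS -mulmxA QP mulmx1.
(* A zero summand would lie in the radical of M. *)
have j0 : j = 0%N.
  apply/eqP/negPn/negP; rewrite -lt0n => lt0j.
  have lt0s : (0 < \sum_(l < j) 1)%N.
    by rewrite big_const_ord iter_addn_0 mul1n.
  pose r := row_mx (row_mx 0 (const_mx 1)) 0 :
    'rV[K]_(\sum_(l < h) (1 + 1) + \sum_(l < j) 1 + p).
  have Sr u : qform S (u + r) = qform S u.
    rewrite -[u]hsubmxK -[lsubmx u]hsubmxK /r !add_row_mx !addr0.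
    by rewrite !qform_qsum !qform_zeros.
  have rQ0 : r *m Q = 0.
    apply: nondeg => u; apply: (addrI (qform M u + qform M (r *m Q))).
    rewrite -qformD addr0 !QM -{1}[u]mulmx1 -PQ mulmxA -mulmxDl QM Sr MS.
    by rewrite -[r]add0r Sr qform0 addr0.
  have /rowP/(_ (lshift p (rshift _ (Ordinal lt0s)))) := isometry_inj QP rQ0.
  by rewrite /r row_mxEl row_mxEr !mxE => /eqP; rewrite oner_eq0.
have dimS := isometric_dim isoM; rewrite j0 big_ord0 big_const_ord iter_addn_0 addn0 in dimS.
(* Otherwise M would be isometric to the anisotropic form C. *)
have h0 : (0 < h)%N.
  rewrite lt0n; apply/eqP => h0; case: aniC; move: (MS v0).
  have : v0 *m P != 0 by apply: contraNneq v0_neq0 => /(isometry_inj PQ) ->.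
  rewrite -[v0 *m P]hsubmxK; set c := rsubmx _.
  have -> : lsubmx (v0 *m P) = 0.
    by apply: rV_dim0; rewrite h0 j0 !big_ord0.
  rewrite qform_qsum qform0 add0r Mv0 => nz Cc; exists c => //.
  by apply: contraNneq nz => ->; rewrite row_mx0.
have toM e f g : plane_of_value S e f g -> exists f' g', plane_of_value M e f' g'.
  exact/isometric_plane/isometric_sym.
have [lt1h|] := ltnP 1 h.
  have [f [g fg]] := hyperbolic_plane j C lt1h.
  by have [f' [g' fg']] := toM _ _ _ fg; exists 0, f', g'; rewrite rmorph0.
move=> le1h; have h1 : h = 1%N by apply/eqP; rewrite eqn_leq le1h.
have p2 : p = 2%N by move: dimS; rewrite h1 => -[->].
have m2 : m = 2%N by rewrite -p2; apply/esym/(isometric_dim isoC).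
have [R [T [RT TR CB]]] := isoC.
have lt0m : (0 < m)%N by rewrite m2.
pose v : 'rV[F]_m := delta_mx 0 (Ordinal lt0m).
have v_neq0 : v != 0.
  by apply/eqP => /rowP/(_ (Ordinal lt0m))/eqP; rewrite !mxE !eqxx oner_eq0.
have c0 : map_mx i v *m T != 0.
  apply: contra v_neq0 => /eqP/(isometry_inj TR)/eqP.
  by rewrite map_mx_eq0.
have [f [g fg]] := mixed_plane j C h0 c0.
have [f' [g' fg']] := toM _ _ _ fg; exists (qform B v), f', g'.
by rewrite -qform_ext -[map_mx i v]mulmx1 -TR mulmxA CB.
Qed.

(** * The form phi over the biquadratic extension *)

Definition vec4 (L : fieldType) (p q r s : L) : 'rV[L]_(1 + 1 + (1 + 1)) :=
  row_mx (row_mx p%:M q%:M) (row_mx r%:M s%:M).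

Definition phi_mx (L : fieldType) (x z w : L) : 'M[L]_(1 + 1 + (1 + 1)) :=
  qsum (qbin 1 (z * (w + x^-1))) (x *: qbin 1 (w * z)).

Lemma vec4P (L : fieldType) (v : 'rV[L]_(1 + 1 + (1 + 1))) : exists p q r s, v = vec4 p q r s.
Proof.
exists (lsubmx (lsubmx v) 0 0), (rsubmx (lsubmx v) 0 0).
exists (lsubmx (rsubmx v) 0 0), (rsubmx (rsubmx v) 0 0).
by rewrite /vec4 -!mx11_scalar !hsubmxK.
Qed.

Lemma vec4_eq0 (L : fieldType) : vec4 0 0 0 0 = 0 :> 'rV[L]_(1 + 1 + (1 + 1)).
Proof. by rewrite /vec4 !raddf0 !row_mx0. Qed.

Lemma scale_vec4 (L : fieldType) (c p q r s : L) :
  c *: vec4 p q r s = vec4 (c * p) (c * q) (c * r) (c * s).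
Proof. by rewrite /vec4 !scale_row_mx !scale_scalar_mx. Qed.

Lemma add_vec4 (L : fieldType) (p q r s p' q' r' s' : L) :
  vec4 p q r s + vec4 p' q' r' s' = vec4 (p + p') (q + q') (r + r') (s + s').
Proof. by rewrite /vec4 !add_row_mx -!raddfD. Qed.

Lemma qform_phi_mx (L : fieldType) (x z w p q r s : L) :
  qform (phi_mx x z w) (vec4 p q r s) = phi x z w p q r s.
Proof.
have qformZl n (a : L) (A : 'M[L]_n) u : qform (a *: A) u = a * qform A u.
  by rewrite /qform -scalemxAr -scalemxAl mxE.
by rewrite qform_qsum qformZl !qform_qbin /phi; ring.
Qed.

Lemma polar_phi_mx (L : fieldType) (two0 : 2%:R = 0 :> L) (x z w p q r s p' q' r' s' : L) :
  polar (phi_mx x z w) (vec4 p q r s) (vec4 p' q' r' s') =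
  p * q' + p' * q + x * (r * s' + r' * s).
Proof.
apply: (addrI (qform (phi_mx x z w) (vec4 p q r s)
  + qform (phi_mx x z w) (vec4 p' q' r' s'))).
by rewrite -qformD add_vec4 !qform_phi_mx /phi; ring: two0.
Qed.

Lemma qext_phi_mx (F L : fieldType) (i : {rmorphism F -> L}) (x z w : F) :
  qext i (phi_mx x z w) = phi_mx (i x) (i z) (i w).
Proof.
rewrite /qext /phi_mx /qsum /qbin.
rewrite map_block_mx map_mxZ !map_block_mx !map_scalar_mx !raddf0.
by rewrite !rmorph1 !rmorphM rmorphD fmorphV.
Qed.

Lemma phi_mx_nondegenerate (L : fieldType) (two0 : 2%:R = 0 :> L)
    (x z w : L) (v : 'rV[L]_(1 + 1 + (1 + 1))) : x != 0 ->
  (forall u, polar (phi_mx x z w) u v = 0) -> v = 0.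
Proof.
move=> x0; have [p [q [r [s ->]]]] := vec4P v => orth.
have := orth (vec4 1 0 0 0); have := orth (vec4 0 1 0 0).
have := orth (vec4 0 0 1 0); have := orth (vec4 0 0 0 1).
rewrite !(polar_phi_mx two0) !(mul0r, mul1r, mulr0, mulr1, addr0, add0r).
move=> /eqP; rewrite mulf_eq0 (negPf x0) => /eqP-> /eqP.
by rewrite mulf_eq0 (negPf x0) => /eqP-> -> ->; exact: vec4_eq0.
Qed.

(** From now on w = l ^+ 2, and l ^+ 4 + l ^+ 2 = 1 says that w is a primitive
    cube root of unity. The long computations below are identities in
    characteristic 2 that hold for every l, once the factor
    l ^+ 4 + l ^+ 2 has been restored in the coefficients. *)

Section IsotropicVectors.

Variables (L : fieldType) (two0 : 2%:R = 0 :> L) (l : L) (ll : l ^+ 4 + l ^+ 2 = 1).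
Variables (al x z : L).
Hypotheses (al_wp : al ^+ 2 + al = x) (x_neq0 : x != 0) (al_l : al + l ^+ 2 != 0).

(* The reductions modulo 2 of the coefficients that the expansions below
   produce. *)
Let even0 n : (2 * n)%:R = 0 :> L.
Proof. by rewrite natrM two0 mul0r. Qed.

Let odd1 n : (1 + 2 * n)%:R = 1 :> L.
Proof. by rewrite natrD even0 addr0. Qed.

Let three1 : 3%:R = 1 :> L := odd1 1.
Let four0 : 4%:R = 0 :> L := even0 2.
Let five1 : 5%:R = 1 :> L := odd1 2.
Let six0 : 6%:R = 0 :> L := even0 3.
Let seven1 : 7%:R = 1 :> L := odd1 3.
Let eight0 : 8%:R = 0 :> L := even0 4.
Let nine1 : 9%:R = 1 :> L := odd1 4.
Let ten0 : 10%:R = 0 :> L := even0 5.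

(** A zero of [phi], found by solving phi = 0 with coordinates affine in b over
    k(al) and separating the coefficients of 1, b and z. The choices
    b = be and b = be + 1 give a hyperbolic pair, up to scaling. *)
Definition iso_vec (b : L) : 'rV[L]_(1 + 1 + (1 + 1)) :=
  vec4 (l * x * b) x (l * (al + 1) * b) (al + l).

Lemma iso_vec_isotropic (b : L) : b ^+ 2 + b = z ->
  qform (phi_mx x z (l ^+ 2)) (iso_vec b) = 0.
Proof.
move=> bz; rewrite qform_phi_mx /phi.
have -> : z * (l ^+ 2 + x^-1) * x ^+ 2 = z * (l ^+ 2 * x + (l ^+ 4 + l ^+ 2)) * x.
  by rewrite ll; field.
by rewrite -al_wp -bz; ring: ten0 nine1 eight0 seven1 six0 five1 four0 three1 two0.
Qed.

Lemma polar_iso_vec (b : L) :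
  polar (phi_mx x z (l ^+ 2)) (iso_vec b) (iso_vec (b + 1)) = l ^+ 2 * x * (al + 1).
Proof.
rewrite (polar_phi_mx two0) -al_wp.
by ring: ten0 nine1 eight0 seven1 six0 five1 four0 three1 two0.
Qed.

(** On the orthogonal complement of h = iso_vec b, the form factors through the
    quotient by h, where it is (al + w) [1, z/x] in the coordinates
    u = U / (al + w) and t = T / (al + w). The second hypothesis then says that
    a vector of the complement with value in V has zero image there. *)
Lemma iso_vec_perp (V : L -> Prop) (b : L) (v : 'rV[L]_(1 + 1 + (1 + 1))) :
  b ^+ 2 + b = z ->
  (forall s t, V ((al + l ^+ 2) * (s ^+ 2 + s * t + z / x * t ^+ 2)) ->
    s = 0 /\ t = 0) ->
  polar (phi_mx x z (l ^+ 2)) v (iso_vec b) = 0 ->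
  V (qform (phi_mx x z (l ^+ 2)) v) ->
  exists c, v = c *: iso_vec b.
Proof.
move=> bz.
have [p [q [r [s ->]]]] := vec4P v.
rewrite (polar_phi_mx two0) qform_phi_mx => aniso perp Vv.
have pE : p = l * b * q + r * (al + l) + l * (al + 1) * b * s.
  apply: (eq_of_add0 two0); apply: (mulfI x_neq0); rewrite mulr0 -[RHS]perp.
  by ring.
pose T := x * s + (al + l) * q.
pose U := r * (al + l ^+ 2) + b * ((l ^+ 2 + l) * q + l ^+ 2 * (al + 1) * s).
have clear : (al + l ^+ 2) * (x * (p ^+ 2 + p * q)
      + z * (l ^+ 2 * x + (l ^+ 4 + l ^+ 2)) * q ^+ 2
      + x ^+ 2 * (r ^+ 2 + r * s + l ^+ 2 * z * s ^+ 2)) =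
    x * (U ^+ 2 + U * T) + z * (l ^+ 4 + l ^+ 2) * T ^+ 2.
  rewrite pE /U /T -al_wp -bz.
  by ring: ten0 nine1 eight0 seven1 six0 five1 four0 three1 two0.
pose u := U / (al + l ^+ 2); pose t := T / (al + l ^+ 2).
have val : phi x z (l ^+ 2) p q r s =
    (al + l ^+ 2) * (u ^+ 2 + u * t + z / x * t ^+ 2).
  apply: (mulfI x_neq0); apply: (mulfI al_l).
  transitivity (x * (U ^+ 2 + U * T) + z * (l ^+ 4 + l ^+ 2) * T ^+ 2).
    by rewrite -clear ll /phi; field.
  by rewrite ll /u /t; move: (U) (T) => U' T'; field; rewrite x_neq0 al_l.
rewrite val in Vv; have [u0 t0] := aniso _ _ Vv.
have T0 : T = 0 by rewrite -[T](divfK al_l) -/t t0 mul0r.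
have U0 : U = 0 by rewrite -[U](divfK al_l) -/u u0 mul0r.
exists (q / x); rewrite scale_vec4; set c := q / x.
have qE : q = c * x by rewrite divfK.
have sE : s = c * (al + l).
  apply: (eq_of_add0 two0); apply: (mulfI x_neq0).
  by rewrite mulr0 -[RHS]T0 /T qE; ring.
have rE : r = c * (l * (al + 1) * b).
  apply: (eq_of_add0 two0); apply: (mulfI al_l).
  rewrite mulr0 -[RHS]U0 /U sE qE -al_wp.
  by move: (c) => d; ring: ten0 nine1 eight0 seven1 six0 five1 four0 three1 two0.
rewrite pE rE sE qE; congr vec4.
by move: (c) => d; ring: ten0 nine1 eight0 seven1 six0 five1 four0 three1 two0.
Qed.

End IsotropicVectors.

(** * The extension is not excellent *)

Lemma closed_field_order3 (k : closedFieldType) : 2%N \in [pchar k] ->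
  exists l : k, l ^+ 2 = l + 1.
Proof.
move=> chark; have two0 : 2%:R = 0 :> k := pcharf0 chark.
have [l lE] := @solve_monicpoly k 2 (fun=> 1) isT.
by exists l; rewrite lE !big_ord_recr big_ord0 /= !mul1r expr0 expr1 add0r addrC.
Qed.

(** If [phi] over K had an anisotropic part defined over F, there would be a plane
    of value in F, which [no_plane_of_value] excludes for the pair of isotropic
    vectors attached to be and be + 1. *)
Lemma biquadratic_not_excellent (k : fieldType) (two0 : 2%:R = 0 :> k) (l : k)
    (l2 : l ^+ 2 = l + 1) (K : fieldExtType (ratfun2 k)) (al be : K) :
  al ^+ 2 + al = in_alg K (ratx k) -> be ^+ 2 + be = in_alg K (ratz k) ->
  <<1 & [:: al; be]>>%VS = {:K}%VS -> ~ excellent (in_alg K).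
Proof.
move=> al_wp be_wp gen exc.
have ll : l ^+ 4 + l ^+ 2 = 1.
  have -> : l ^+ 4 = (l + 1) ^+ 2 by rewrite -l2; ring.
  transitivity (1 + 2%:R * (l ^+ 2 + l)); first by ring.
  by rewrite two0 mul0r addr0.
have ww : (l ^+ 2) ^+ 2 = l ^+ 2 + 1.
  by rewrite -ll -exprM; ring: two0.
have := exc _ (phi_mx (ratx k) (ratz k) (ratconst k (l ^+ 2))).
case=> [[v v0]|m [B [p [C [CA CB]]]]].
  have [v1 [v2 [v3 [v4 vE]]]] := vec4P v.
  rewrite vE qform_phi_mx => /(phi_rat_anisotropic two0 ww)[v10 v20 v30 v40].
  by case/eqP: v0; rewrite vE v10 v20 v30 v40 vec4_eq0.
have twoK := two0K two0 K.
pose L := in_alg K (ratconst k l); pose X := in_alg K (ratx k).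
have LL : L ^+ 4 + L ^+ 2 = 1.
  by rewrite /L -!rmorphXn -!rmorphD ll !rmorph1.
have X0 : X != 0 by rewrite fmorph_eq0 ratx_neq0.
have L0 : L != 0.
  rewrite /L !fmorph_eq0; apply/eqP => l0; move/eqP: l2.
  by rewrite l0 expr0n add0r eq_sym oner_eq0.
have wE : in_alg K (ratconst k (l ^+ 2)) = L ^+ 2 by rewrite !rmorphXn.
have al_notF c : al + in_alg K c != 0.
  apply: contraNneq (al_notin two0 al_wp) => /(eq_of_add0 twoK) ->.
  by rewrite (in_alg_mem c 1%AS).
have alL : al + L ^+ 2 != 0 by rewrite -wE al_notF.
have al1 : al + 1 != 0 by rewrite -(rmorph1 (in_alg K)) al_notF.
pose M := phi_mx X (in_alg K (ratz k)) (L ^+ 2).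
have extM : qext (in_alg K) (phi_mx (ratx k) (ratz k) (ratconst k (l ^+ 2))) = M.
  by rewrite /M -wE; apply: qext_phi_mx.
rewrite extM in CA.
have polar_neq0 : polar M (iso_vec L al X be) (iso_vec L al X (be + 1)) != 0.
  by rewrite (polar_iso_vec twoK) // !mulf_neq0 ?expf_neq0.
have [||e [f [g plane]]] := defined_anisotropic_part_plane _ _ CA CB.
- by move=> v; apply: phi_mx_nondegenerate.
- exists (iso_vec L al X be); last exact: iso_vec_isotropic.
  apply: contraNneq polar_neq0 => h0; have := polar_lin M 0 0 0 0 (iso_vec L al X (be + 1)).
  by rewrite h0 scale0r add0r !mul0r addr0 => ->.
pose V c := exists f : ratfun2 k, c = in_alg K f.
have twisted_norm' s t :
    V ((al + L ^+ 2) * (s ^+ 2 + s * t + in_alg K (ratz k) / X * t ^+ 2)) ->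
    s = 0 /\ t = 0.
  by move=> [c]; rewrite -wE; apply: (twisted_norm two0 ww al_wp be_wp).
apply: (no_plane_of_value twoK (V := V) (M := M)
  (h0 := iso_vec L al X be) (h1 := iso_vec L al X (be + 1)) _ _ _ _ _ plane).
- by exists 0; rewrite rmorph0.
- exact: polar_neq0.
- by move=> v; apply: (iso_vec_perp twoK LL al_wp X0 alL be_wp twisted_norm').
- move=> v; apply: (iso_vec_perp twoK LL al_wp X0 alL _ twisted_norm').
  by rewrite (wpD twoK) be_wp expr1n -[1 + 1]mulr2n twoK addr0.
- by exists e.
Qed.

Unset Implicit Arguments.

Theorem mainTheorem3 (k : closedFieldType) (chark : 2%N \in [pchar k])
    (K : fieldExtType (ratfun2 k)) (alpha beta : K)
    (Halpha : wp_inv (ratx k) alpha)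
    (Hbeta : wp_inv ((ratx k) ^- 2 * (raty k)^-1 + 1) beta)
    (HK : <<1 & [:: alpha; beta]>>%VS = {:K}%VS) :
  \dim {:K} = 4%N /\ ~ excellent (in_alg K).
Proof.
have two0 : 2%:R = 0 :> k := pcharf0 chark.
have [l l2] := closed_field_order3 chark.
have twoK := two0K two0 K.
have wpE e v : wp_inv e v -> v ^+ 2 + v = in_alg K e.
  by rewrite /wp_inv /root !hornerE => /eqP/(eq_of_add0 twoK).
(* Adding wp^-1(1), which lies in k, replaces z + 1 by z. *)
pose c := in_alg K (ratconst k l).
have cE : c ^+ 2 + c = 1.
  have l1 : l ^+ 2 + l = 1.
    transitivity (1 + 2%:R * l); first by rewrite l2; ring.
    by rewrite two0 mul0r addr0.
  rewrite -(rmorph1 (in_alg K)) -(rmorph1 (ratconst k)) -l1.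
  rewrite !(rmorphD (ratconst k)) !(rmorphXn (ratconst k)).
  by rewrite (rmorphD (in_alg K)) (rmorphXn (in_alg K)).
pose be := beta + c.
have be_wp : be ^+ 2 + be = in_alg K (ratz k).
  rewrite (wpD twoK) cE (wpE _ _ Hbeta) rmorphD rmorph1 -addrA.
  by rewrite -[1 + 1]mulr2n twoK addr0.
have gen : <<1 & [:: alpha; be]>>%VS = {:K}%VS.
  apply/eqP; rewrite eqEsubv subvf /= -HK; apply/Fadjoin_seqP; split.
    by rewrite sub1v.
  have memE v : v \in [:: alpha; be] -> v \in <<1 & [:: alpha; be]>>%VS.
    exact/seqv_sub_adjoin.
  move=> v; rewrite !inE => /orP[]/eqP->; first by rewrite memE ?mem_head.
  have -> : beta = be - c by rewrite /be addrK.
  by rewrite rpredB ?in_alg_mem // memE // !inE eqxx orbT.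
split; first exact: (dim_K two0 (wpE _ _ Halpha) be_wp).
exact: (biquadratic_not_excellent two0 l2 (wpE _ _ Halpha) be_wp gen).
Qed.
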